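(* There exist positive numerical constants $c_1$ and $c_2$ such that the following holds for any $n\ge2$, $m\ge1$, $\delta\in(0,1)$ and any distribution in the univariate nonparametric model. With probability higher than $1-\delta$, the change-point estimator $\hat\tau$ described in the context satisfies (NoSp) and detects all change-points $\tau_k$ that have high energy in the sense that $$r_k\|F_{\tau_k}-F_{\tau_{k-1}}\|_\infty^2\ge\frac{c_1}m\log\Big(\frac n{r_k\delta}\Big).$$ Besides, on the same event, any such high-energy change-point $\tau_k$ satisfies $$d_{H,1}(\hat\tau,\tau_k)\le c_2\,\frac{\log\big(\delta^{-1}nm\|F_{\tau_k}-F_{\tau_{k-1}}\|_\infty^2\big)}{m\|F_{\tau_k}-F_{\tau_{k-1}}\|_\infty^2}\le\frac{r_k}4 .$$
   Context: Univariate nonparametric model. Let $m\ge1$. The $y_t$, $t=1,\dots,n$, are independent and $y_t$ is an i.i.d. sample of size $m$ from a distribution on $\mathbb R$ with cumulative distribution function $F_t$. The change-points $1=\tau_0<\tau_1<\dots<\tau_K<\tau_{K+1}=n+1$ are such that $F_t$ is constant in $t$ on each $[\tau_k,\tau_{k+1}-1]$ and $F_{\tau_k}\ne F_{\tau_k-1}$; $r_k=\min(\tau_{k+1}-\tau_k,\tau_k-\tau_{k-1})$. $\|F-G\|_\infty=\sup_{z\in\mathbb R}|F(z)-G(z)|$. Dyadic grid $\mathcal G_D$: scales $\mathcal R=\{1,2,4,\dots,2^{\lfloor\log_2 n\rfloor-1}\}$; locations $\mathcal D_1=\{2,\dots,n\}$ and, for $r\in\mathcal R$, $r\ge2$, $\mathcal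 D_r=\{m'\frac r2+1: m'\in\mathbb N,\ 2\le m'\le\lfloor 2n/r\rfloor-2\}\cup\{n-r+1\}$; $\mathcal G_D=\{(l,r):r\in\mathcal R,l\in\mathcal D_r\}$. Tests. With $\widehat F_t$ the empirical distribution function of the sample $y_t$, $$T_{l,r}=\mathbf 1\Big\{\Big\|r^{-1}\Big(\sum_{t=l}^{l+r-1}\widehat F_t-\sum_{t=l-r}^{l-1}\widehat F_t\Big)\Big\|_\infty\ge\sqrt{2\,\tfrac{\log(4n/(\delta r))}{mr}}\Big\},\quad(l,r)\in\mathcal G_D.$$ Estimator (bottom-up aggregation). For $r\in\mathcal R$ increasing define (closed real intervals) $\mathcal T_r=\{l\in\mathcal D_r:T_{l,r}=1,\ [l-r+1,l+r-1]\cap\bigcup_{r'<r,r'\in\mathcal R}\mathcal S_{r'}=\emptyset\}$ and $\mathcal S_r=\bigcup_{l\in\mathcal T_r}[l-r+1,l+r-1]$. Let $C_1,\dots,C_{\hat K}$ be the connected components of $\bigcup_r\mathcal S_r$ in increasing order, and $\hat\tau_k=\frac12(\min C_k+\max C_k)$. (NoSp): for all $1\le k\le K$ the interval $[\tau_k-\frac{\tau_k-\tau_{k-1}}2,\tau_k+\frac{\tau_{k+1}-\tau_k}2]$ contains at most one $\hat\tau_{k'}$, and all $\hat\tau_{k'}$ lie in $[\tau_1-\frac{\tau_1-1}2,\tau_K+\frac{n+1-\tau_K}2]$; for $K=0$ it means $\hat K=0$. A change-point $\tau_k$ is detected if at least one $\hat\tau_{k'}$ lies in $[\tau_k-\frac{\tau_k-\tau_{k-1}}2,\tau_k+\frac{\tau_{k+1}-\tau_k}2]$.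 $d_{H,1}(\hat\tau,\tau_k)=\min_{l\le\hat K}|\hat\tau_l-\tau_k|$ ($+\infty$ if $\hat K=0$). *)

(* Defs.v *)
From HB Require Import structures.
From mathcomp Require Import all_boot all_order all_algebra.
From mathcomp Require Import all_classical all_reals all_analysis.

Set Implicit Arguments.
Unset Strict Implicit.
Unset Printing Implicit Defensive.

Import Order.TTheory GRing.Theory Num.Theory.
Import numFieldNormedType.Exports.

Local Open Scope classical_set_scope.
Local Open Scope ring_scope.

(* Only used on bounded functions, where the [sup] of the library is the
   supremum. *)
Definition supnorm (R : realType) (f : R -> R) : R :=
  sup (range (fun z => `|f z|)).

Section Independence.
Context d (T : measurableType d) (R : realType) (P : probability T R).

Definition mutually_independent (I : finType) (X : I -> {RV P >-> R}) : Prop :=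
  forall (J : {set I}) (B : I -> set R),
    (forall i, measurable (B i)) ->
    P (\bigcap_(i in [set i | i \in J]) (X i @^-1` B i)) =
    (\prod_(i in J) P (X i @^-1` B i))%E.

End Independence.

Section Model.
Context d (T : measurableType d) (R : realType) (P : probability T R).
Variables (n m : nat) (Y : nat -> 'I_m -> {RV P >-> R}).
Variables (F : nat -> R -> R) (K : nat) (tau : nat -> nat).

(* Times run over 1, ..., n; the values of [Y] and [F] at other times, and of
   [tau] beyond K.+1, are irrelevant. *)
Record univariate_model : Prop := UnivariateModel {
  model_indep :
    mutually_independent (fun p : 'I_n * 'I_m => Y p.1.+1 p.2);
  model_cdf : forall (t : nat) (i : 'I_m) (z : R),
    (1 <= t <= n)%N -> cdf (Y t i) z = (F t z)%:E;
  model_tau_first : tau 0%N = 1%N;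
  model_tau_last : tau K.+1 = n.+1;
  model_tau_incr : forall k, (k <= K)%N -> (tau k < tau k.+1)%N;
  model_const : forall k t, (k <= K)%N ->
    (tau k <= t < tau k.+1)%N -> F t = F (tau k);
  model_jump : forall k, (1 <= k <= K)%N -> F (tau k) <> F (tau k).-1
}.

End Model.

Section ChangePoints.
Context {R : realType}.
Variables (F : nat -> R -> R) (tau : nat -> nat).

Definition segment_radius (k : nat) : nat :=
  minn (tau k.+1 - tau k) (tau k - tau k.-1).

Definition jump_height (k : nat) : R :=
  supnorm (fun z => F (tau k) z - F (tau k.-1) z).

Definition left_end (k : nat) : R :=
  (tau k)%:R - ((tau k)%:R - (tau k.-1)%:R) / 2.

Definition right_end (k : nat) : R :=
  (tau k)%:R + ((tau k.+1)%:R - (tau k)%:R) / 2.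

Definition cell (k : nat) : set R := `[left_end k, right_end k].

Definition high_energy (n m : nat) (delta c1 : R) (k : nat) : Prop :=
  c1 / m%:R * ln (n%:R / ((segment_radius k)%:R * delta)) <=
  (segment_radius k)%:R * jump_height k ^+ 2.

Definition localization_bound (n m : nat) (delta c2 : R) (k : nat) : R :=
  c2 * (ln (delta^-1 * n%:R * m%:R * jump_height k ^+ 2) /
        (m%:R * jump_height k ^+ 2)).

End ChangePoints.

(* An estimated vector of change-points is a real family [that] indexed by a
   set [J] of indices. *)
Section Criteria.
Context {R : realType} (I : Type).
Variables (J : set I) (that : I -> R) (K : nat) (tau : nat -> nat).

Definition no_spurious : Prop :=
  if K is 0%N then J = set0 else
  (forall k, (1 <= k <= K)%N -> forall i j, J i -> J j ->
    that i \in cell tau k -> that j \in cell tau k -> i = j) /\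
  (forall i, J i -> left_end tau 1 <= that i <= right_end tau K).

Definition detected (k : nat) : Prop :=
  exists2 i, J i & that i \in cell tau k.

(* The minimum over an empty family is +oo. *)
Definition dist_H1 (x : R) : \bar R :=
  ereal_inf [set (`|that i - x|)%:E | i in J].

End Criteria.

Definition scale_count (n : nat) : nat := trunc_log 2 n.

(* [locations n r] is the set D_r; the scales are r = 2 ^ j with
   j < scale_count n. *)
Definition locations (n r : nat) : set nat :=
  if r == 1%N then [set l | (2 <= l <= n)%N] else
  [set (q * (r %/ 2) + 1)%N | q in [set q | (2 <= q <= (2 * n) %/ r - 2)%N]]
  `|` [set (n - r + 1)%N].

Section Estimator.
Context {R : realType} (n m : nat) (delta : R).
Variable y : nat -> 'I_m -> R.

Definition ecdf (t : nat) (z : R) : R :=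
  m%:R^-1 * \sum_(i < m) (y t i <= z)%R%:R.

Definition cusum (l r : nat) (z : R) : R :=
  r%:R^-1 * (\sum_(l <= t < l + r) ecdf t z - \sum_(l - r <= t < l) ecdf t z).

Definition threshold (r : nat) : R :=
  Num.sqrt (2 * (ln (4 * n%:R / (delta * r%:R)) / (m%:R * r%:R))).

Definition test (l r : nat) : bool := threshold r <= supnorm (cusum l r).

Definition test_interval (l r : nat) : set R :=
  `[l%:R - r%:R + 1, l%:R + r%:R - 1].

(* In [selected r U] and [covered_at r U], [U] is the union of the regions
   S_{r'} over the scales r' < r. *)
Definition selected (r : nat) (U : set R) : set nat :=
  [set l | [/\ locations n r l, test l r & test_interval l r `&` U = set0]].

Definition covered_at (r : nat) (U : set R) : set R :=
  \bigcup_(l in selected r U) test_interval l r.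

(* Union of the regions S_{2 ^ i}, i < j. *)
Fixpoint covered (j : nat) : set R :=
  if j is j'.+1 then covered j' `|` covered_at (2 ^ j') (covered j') else set0.

(* The estimator is indexed by the connected components themselves. *)
Definition components : set (set R) :=
  [set connected_component (covered (scale_count n)) x
     | x in covered (scale_count n)].

End Estimator.

(* Applied to the components above, which are compact intervals, so that
   [inf] and [sup] are the minimum and the maximum. *)
Definition midpoint (R : realType) (C : set R) : R := (inf C + sup C) / 2.

(* Main.v *)
Require Import Defs.
From HB Require Import structures.
From mathcomp Require Import all_boot all_order all_algebra.
From mathcomp Require Import all_classical all_reals all_analysis.
From mathcomp Require Import measurable_realfun.
From mathcomp Require Import zify ring lra.
Import Order.TTheory GRing.Theory Num.Theory.
Import numFieldNormedType.Exports.

(** Two deterministic facts reduce the theorem to the behaviour of single tests.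
    The first is that every selected interval contains a change-point as soon as
    no test fires on a window where the distribution is constant.  A connected
    component of the selected region is then a closed interval containing a
    change-point, and if its midpoint falls in the cell of a change-point it
    contains that very change-point, for otherwise it would be too short to reach
    any other one.  Two components never share a point, whence (NoSp)
    ([no_spurious_components]).

    The second is that, if a test at scale [r] fires close to a change-point
    [tau_k] and [4 (r - 1)] is less than the radius of [tau_k], then [tau_k] is
    covered at some scale at most [r]: either this very interval is selected, or
    it meets an interval selected earlier, which is too close to [tau_k] to owe
    its presence to another change-point.  Selected intervals of different scales
    are disjoint, and those of the same scale that avoid [tau_k] are far from it,
    so the component of [tau_k] is the union of the intervals containing [tau_k],
    and its midpoint is within [r - 1] of [tau_k] ([detection]).

    Probabilistically, the union over the grid leaves no room in the constant of
    the threshold: bounding the two empirical distribution functions separately,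
    even with the sharp Dvoretzky-Kiefer-Wolfowitz constant, gives error
    probabilities proportional to [r / n], whose sum over the [2 n / r] locations
    of all scales grows like [log n].  The two samples of size [N = m r] have to
    be compared directly.  By exchangeability, the law of their difference is an
    average over all ways of splitting the pooled sample in two halves; once the
    pooled values are sorted, a split is a path with [N] steps up and [N] down,
    the statistic is its maximal height, and the reflection principle bounds the
    tail by [2 C(2N, N + k) / C(2N, N) <= 2 exp (1/2 - k^2 / N)]
    ([two_sample_tail]).  This squares [r / n], and the sum over the grid is less
    than [delta / 2] ([null_test_tail], [null_budget]).

    For the power, one level [z] where [F_{tau_k}] and [F_{tau_k - 1}] nearly
    realize their distance [Delta] suffices, so a Chernoff bound for Bernoulli
    variables is enough ([cusum_deviation]).  With [E = m Delta^2] and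
    [L = ln (n E / delta)], the scale used is the least power of two above
    [128 L / E]: it is of the order of the announced localization bound, and the
    corresponding test misses with probability at most [delta r_k / (2 n)]
    ([high_energy_test]).  The radii [r_k] add up to at most [n], so all these
    failures together cost at most [delta / 2]. *)

Set Implicit Arguments.
Unset Strict Implicit.
Unset Printing Implicit Defensive.

(** * Lattice paths: the reflection principle *)

Fixpoint bool_seqs (n : nat) : seq (seq bool) :=
  if n is n'.+1 then
    map (cons true) (bool_seqs n') ++ map (cons false) (bool_seqs n')
  else [:: [::]].

(** The path with steps up for [true] and down for [false] reaches height [h]. *)
Fixpoint hits (h : nat) (s : seq bool) : bool :=
  if h is h'.+1 then
    if s is b :: s' then hits (if b then h' else h.+1) s' else false
  else true.

Lemma mem_bool_seqs n s : (s \in bool_seqs n) = (size s == n).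
Proof.
elim: n s => [|n IHn] [|b s] /=.
- by rewrite inE.
- by rewrite inE.
- by rewrite mem_cat; apply/negbTE/norP; split; apply/mapP => -[].
rewrite mem_cat eqSS -IHn; have inj (c : bool) : injective (cons c) by move=> x y [].
have nin (c : bool) : (~~ c :: s \in map (cons c) (bool_seqs n)) = false.
  by apply/mapP => -[x _ []]; case: c.
by case: b; rewrite (mem_map (@inj _)) ?(nin true) ?(nin false) ?orbF.
Qed.

Lemma count_bool_seqs n u :
  count (fun s => count id s == u) (bool_seqs n) = 'C(n, u).
Proof.
elim: n u => [|n IHn] u /=; first by case: u.
rewrite count_cat !count_map; case: u => [|u].
  rewrite (eq_count (a2 := pred0)) // count_pred0 add0n.
  by rewrite (eq_count (a2 := fun s => count id s == 0)) // IHn !bin0.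
rewrite binS addnC -(IHn u) -(IHn u.+1).
by congr (_ + _); apply: eq_count => s /=.
Qed.

(** Reflecting a path after its first visit to height [h] would turn the paths
    counted here into those ending at the mirror image of their endpoint, which
    have [h + n - u] steps up.  The induction replaces this bijection by Pascal's
    rule: both sides split according to the first step. *)
Lemma count_hits n u h : u.*2 <= n + h ->
  count (fun s => (count id s == u) && hits h s) (bool_seqs n)
    <= 'C(n, h + n - u).
Proof.
elim: n u h => [|n IHn] u [|h] ule.
- have -> : u = 0 by lia.
  by rewrite /= .
- by rewrite /= andbF.
- have -> : 0 + n.+1 - u = n.+1 - u by lia.
  rewrite bin_sub; last by lia.
  by rewrite -count_bool_seqs; apply: sub_count => s /=; case/andP.
have -> : h.+1 + n.+1 - u = (h.+1 + n - u).+1 by lia.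
rewrite [bool_seqs _]/= count_cat !count_map binS addnC; apply: leq_add.
  apply: leq_trans (leq_trans (IHn u h.+2 _) _); [|lia|].
    by rewrite sub_count // => s.
  by apply: eq_leq; congr 'C(n, _); lia.
case: u ule => [|u] ule.
  by rewrite (eq_count (a2 := pred0)) ?count_pred0.
apply: leq_trans (leq_trans (IHn u h _) _); [|lia|].
  by rewrite sub_count // => s.
by apply: eq_leq; congr 'C(n, _); lia.
Qed.

Lemma hits_take h s j :
  h + count negb (take j s) <= count id (take j s) -> hits h s.
Proof.
elim: s h j => [|b s IHs] [|h] [|j] //= hle; apply: (IHs _ j).
by case: b hle => /=; lia.
Qed.

Lemma filter_sorted_take (I : Type) (b : I -> nat) v (e : seq I) :
  sorted (relpre b leq) e ->
  [seq i <- e | b i <= v] = take (count (fun i => b i <= v) e) e.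
Proof.
elim: e => //= x e IHe sxe; have := IHe (path_sorted sxe).
case: leqP => [_|vx] /=; first by move->.
have -> : count (fun i => b i <= v) e = 0.
  apply/eqP; rewrite -leqn0 leqNgt -has_count -all_predC.
  have tr : transitive (relpre b leq) by move=> ? ? ? /=; apply: leq_trans.
  apply: sub_all (order_path_min tr sxe) => y /= xy.
  by rewrite -ltnNge (leq_trans vx xy).
by move=> ->; rewrite !take0.
Qed.

Section SubsetCount.
Variable (I : finType).
Implicit Type S : {set I}.

(** The subtraction is truncated, so this is the positive part of a difference. *)
Definition excess (P : pred I) S : nat :=
  #|[set i in S | P i]| - #|[set i in ~: S | P i]|.

(** Once the elements of [I] are sorted by [b], a sublevel set of [b] is an
    initial segment, and its excess is the height at that time of the path that
    goes up on [S] and down off [S]. *)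
Lemma card_excess_ge N k (b : I -> nat) (V : finType) (lev : V -> nat) :
  #|I| = N.*2 ->
  #|[set S : {set I} | (#|S| == N) && [exists v, k <= excess (fun i => b i <= lev v) S]]|
    <= 'C(N.*2, N + k).
Proof.
move=> cI; case: k => [|k].
  rewrite addn0 -cI -card_draws; apply: subset_leq_card.
  by apply/fintype.subsetP => S; rewrite !inE => /andP[].
set A := [set S : {set I} | _].
have etr : total (relpre b leq) by move=> x y /=; apply: leq_total.
pose e := sort (relpre b leq) (enum I).
have pe : perm_eq e (enum I) by rewrite /e perm_sort.
have szE : size e = N.*2 by rewrite (perm_size pe) -cardE.
have cntE (P : pred I) : count P e = #|P|.
  by rewrite (permP pe) cardE enumT -size_filter.
pose f S := [seq i \in S | i <- e].
have f_inj : injective f.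
  move=> S1 S2 /eq_in_map eqf; apply/setP => i; apply: eqf.
  by rewrite (perm_mem pe) mem_enum.
rewrite cardE -(size_map f).
have -> : N + k.+1 = k.+1 + N.*2 - N by lia.
apply: leq_trans (count_hits _); last by lia.
rewrite -size_filter; apply: uniq_leq_size.
  by rewrite map_inj_uniq ?enum_uniq.
move=> _ /mapP[S + ->]; rewrite mem_enum inE => /andP[/eqP cS /existsP[v kv]].
rewrite mem_filter mem_bool_seqs size_map szE eqxx andbT.
have -> /= : count id (f S) == N.
  by rewrite count_map -[in X in _ == X]cS cntE; apply/eqP/eq_card.
have sorted_e : sorted (relpre b leq) e by apply: sort_sorted.
apply: (@hits_take _ _ (count (fun i => b i <= lev v) e)).
rewrite -map_take -filter_sorted_take // !count_map !count_filter !cntE.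
move: kv; rewrite /excess !cardsE.
have -> : #|[pred i in ~: S | b i <= lev v]| =
          #|predI (fun i => ~~ (i \in S)) (fun i => b i <= lev v)|.
  by apply: eq_card => i; rewrite !inE.
rewrite -[#|[pred i in S | _]|]/(#|predI (mem S) (fun i => b i <= lev v)|) => kv.
have subD x y : k.+1 <= x - y -> k.+1 + y <= x by lia.
exact: subD kv.
Qed.

Definition excess_abs (P : pred I) S : nat :=
  maxn (excess P S) (excess P (~: S)).

Lemma excess_reindex (s : I -> I) (P : pred I) S : injective s ->
  excess P (s @: S) = excess (fun i => P (s i)) S.
Proof.
move=> s_inj; have cE (A : {set I}) :
    #|[set i in s @: A | P i]| = #|[set i in A | P (s i)]|.
  rewrite -[RHS](card_imset _ s_inj); apply: eq_card => i; rewrite !inE.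
  apply/andP/imsetP => [[/imsetP[j jA ->] Pj]|[j + ->]].
    by exists j => //; rewrite inE jA.
  by rewrite inE => /andP[jA Pj]; rewrite imset_f.
rewrite /excess cE -(cE (~: S)); congr (_ - _); apply: eq_card => i; rewrite !inE.
congr (_ && _); apply/idP/imsetP => [iS|[j + ->]]; last first.
  by rewrite inE; apply: contra => /imsetP[j' j'S /s_inj ->].
have [s' s's ss'] := injF_bij s_inj.
by exists (s' i); rewrite // inE; apply: contra iS => h; rewrite -(ss' i) imset_f.
Qed.

Lemma excess_abs_reindex (s : I -> I) (P : pred I) S : injective s ->
  excess_abs P (s @: S) = excess_abs (fun i => P (s i)) S.
Proof.
move=> s_inj; rewrite /excess_abs excess_reindex //; congr maxn.
have <- : s @: (~: S) = ~: (s @: S); last exact: excess_reindex.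
apply/setP => i; rewrite inE.
have [s' s's ss'] := injF_bij s_inj.
by rewrite -(ss' i) !mem_imset // inE.
Qed.

Lemma eq_excess_abs (P Q : pred I) S : P =1 Q ->
  excess_abs P S = excess_abs Q S.
Proof.
move=> PQ; have E (A : {set I}) : #|[set i in A | P i]| = #|[set i in A | Q i]|.
  by apply: eq_card => i; rewrite !inE PQ.
by rewrite /excess_abs /excess !E.
Qed.

Lemma card_excess_abs_ge N k (b : I -> nat) (V : finType) (lev : V -> nat) :
  #|I| = N.*2 ->
  #|[set S : {set I} | (#|S| == N) && [exists v, k <= excess_abs (fun i => b i <= lev v) S]]|
    <= 'C(N.*2, N + k).*2.
Proof.
move=> cI; rewrite -addnn.
set A := [set S : {set I} | (#|S| == N) && [exists v, k <= excess (fun i => b i <= lev v) S]].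
apply: leq_trans (leq_add (card_excess_ge k b lev cI) (card_excess_ge k b lev cI)).
rewrite -/A -{2}(card_imset A (@finset.setC_inj I)) -cardsUI.
apply: leq_trans (leq_addr _ _); apply: subset_leq_card.
apply/fintype.subsetP => S; rewrite !inE => /andP[cS /existsP[v]].
rewrite leq_max => /orP[kv|kv].
  by rewrite cS; apply/orP; left; apply/existsP; exists v.
apply/orP; right; apply/imsetP; exists (~: S); last by rewrite finset.setCK.
rewrite inE; apply/andP; split; last by apply/existsP; exists v.
by have := cardsC S; move/eqP: cS; rewrite cI => -> H; apply/eqP; lia.
Qed.
End SubsetCount.

Local Open Scope classical_set_scope.
Local Open Scope ring_scope.

(** * Elementary inequalities *)

Section Inequalities.
Variable R : realType.
Implicit Types x : R.

(** The difference of the two sides vanishes at [0] and has derivative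
    [1 - (1 - 2 x) exp (2 x)], which is nonnegative by [1 - 2 x <= exp (- 2 x)]. *)
Lemma ratio_le_expR x : 0 <= x -> (1 - x) * expR (2 * x) <= 1 + x.
Proof.
move=> x0; rewrite -subr_ge0.
pose f (y : R) : R := 1 + y - (1 - y) * expR (2 * y).
have df (y : R) : is_derive y 1 f (1 - (1 - 2 * y) * expR (2 * y)).
  apply: is_derive_eq; rewrite /GRing.scale /=; ring.
have -> : 0 = f 0 by rewrite /f mulr0 expR0; ring.
apply: (@ger0_derive1_ndecr _ f 0 x) => //.
- move=> y _; rewrite derive1E derive_val subr_ge0.
  rewrite -ler_pdivlMr ?expR_gt0 // div1r -expRN.
  by apply: le_trans (expR_ge1Dx _); lra.
- apply: continuous_subspaceT => y; apply: differentiable_continuous.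
  by apply/derivable1_diffP.
Qed.

Lemma expR_half_le2 : expR (1 / 2) <= 2 :> R.
Proof.
have := expR_ge1Dx (- (1 / 2) : R); have := expR_gt0 (1 / 2 : R).
rewrite expRN; move: (expR _) => e e0.
by rewrite -(ler_pM2r e0) mulVf ?gt_eqF //; lra.
Qed.

(** Squaring [1 - x / 2 <= exp (- x / 2)] bounds [exp x] by [(1 - x / 2)^-2].
    The remaining polynomial inequality amounts to [0 <= 1 - 3 x + x^2]. *)
Lemma expR_le_quadratic x : x <= 1 / 3 -> expR x <= 1 + x + x ^+ 2.
Proof.
move=> x3; have h : (1 - x / 2) * expR (x / 2) <= 1.
  rewrite -ler_pdivlMr ?expR_gt0 // div1r -expRN.
  by apply: le_trans (expR_ge1Dx _); lra.
have h0 : 0 < 1 - x / 2 by lra.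
have -> : x = x / 2 + x / 2 by lra.
rewrite expRD -(ler_pM2l (mulr_gt0 h0 h0)).
have e0 := expR_gt0 (x / 2).
have -> : (1 - x / 2) * (1 - x / 2) * (expR (x / 2) * expR (x / 2)) =
  ((1 - x / 2) * expR (x / 2)) ^+ 2 by ring.
apply: (@le_trans _ _ 1).
  by rewrite -[leRHS](expr1n _ 2) ler_pXn2r // nnegrE ?mulr_ge0 // ltW.
have : 0 <= x ^+ 2 * (1 - 3 * x + x ^+ 2).
  by apply: mulr_ge0; [exact: sqr_ge0|have := sqr_ge0 x; lra].
have -> : x ^+ 2 * (1 - 3 * x + x ^+ 2) = 4 * (
 (1 - x / 2) * (1 - x / 2) * (1 + (x / 2 + x / 2) + (x / 2 + x / 2) ^+ 2) - 1) by field.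
lra.
Qed.

(** Passing from [k] to [k + 1] multiplies the coefficient by [(1 - x) / (1 + x)]
    with [x = (2 k + 1) / (2 N + 1)] and the exponential by [exp (- 2 x)], so
    [ratio_le_expR] is the induction step. *)
Lemma central_binomial_ratio (N k : nat) : (k <= N)%N ->
  ('C(N.*2, N + k))%:R <=
    ('C(N.*2, N))%:R * expR (- (2 * k%:R ^+ 2 / (2 * N%:R + 1))) :> R.
Proof.
elim: k => [|k IHk] kN; first by rewrite addn0 expr0n /= mulr0 mul0r oppr0 expR0 mulr1.
have := IHk (ltnW kN); set u := 'C(_, _)%:R => IH.
have step : ((N + k).+1 * 'C(N.*2, (N + k).+1) = (N - k) * 'C(N.*2, N + k))%N.
  by have := mul_bin_left N.*2 (N + k); rewrite (_ : N.*2 - (N + k) = N - k)%N //; lia.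
rewrite addnS.
have N0 : 0 < 2 * N%:R + 1 :> R by rewrite ltr_wpDl ?mulr_ge0.
pose x : R := (2 * k%:R + 1) / (2 * N%:R + 1).
have x0 : 0 <= x by rewrite divr_ge0 ?addr_ge0 ?mulr_ge0 // ltW.
have rx := ratio_le_expR x0.
have kNR : k%:R + 1 <= N%:R :> R by rewrite natr1 ler_nat.
have stepR : (N + k).+1%:R * 'C(N.*2, (N + k).+1)%:R = (N%:R - k%:R) * u :> R.
  by rewrite -natrM step natrM natrB // ltnW.
rewrite -(ler_pM2l (ltr0Sn R (N + k))) stepR.
set v := 'C(_, _)%:R.
have -> : 2 * k.+1%:R ^+ 2 / (2 * N%:R + 1) =
    2 * k%:R ^+ 2 / (2 * N%:R + 1) + 2 * x.
  by rewrite /x -natr1; field; rewrite gt_eqF.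
rewrite opprD expRD.
set E := expR (- (2 * k%:R ^+ 2 / _)).
have E0 : 0 < E := expR_gt0 _.
have v0 : 0 <= v by rewrite ler0n.
apply: (@le_trans _ _ ((N%:R - k%:R) * (v * E))).
  by rewrite ler_wpM2l // subr_ge0 ler_nat ltnW.
have -> : (N + k).+1%:R = N%:R + k%:R + 1 :> R by rewrite -natr1 natrD.
have e : N%:R - k%:R <= (N%:R + k%:R + 1) * expR (- (2 * x)) :> R.
  rewrite expRN -ler_pdivrMr ?invr_gt0 ?expR_gt0 // invrK.
  have -> : N%:R - k%:R = (1 - x) * ((2 * N%:R + 1) / 2) :> R.
    by rewrite /x; field; rewrite gt_eqF.
  have -> : N%:R + k%:R + 1 = (1 + x) * ((2 * N%:R + 1) / 2) :> R.
    by rewrite /x; field; rewrite gt_eqF.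
  rewrite mulrAC ler_wpM2r // ltW // divr_gt0 //.
have vE0 : 0 <= v * E by rewrite mulr_ge0 // ltW.
apply: le_trans (ler_wpM2r vE0 e) _.
by rewrite le_eqVlt; apply/orP; left; apply/eqP; ring.
Qed.

End Inequalities.

(** * Independent variables sorted into finitely many classes *)

Section Law.
Context d (T : measurableType d) (R : realType) (P : probability T R).

(** The open half-lines form a pi-system generating the Borel
    sets, and their probabilities are read off the distribution function. *)
Lemma eq_law (X X' : {RV P >-> R}) : (forall z, cdf X z = cdf X' z) ->
  forall A, measurable A -> P (X @^-1` A) = P (X' @^-1` A).
Proof.
move=> XX' A mA.
suff : distribution P X A = distribution P X' A by [].
have mA' : <<s @RGenOInfty.G R >> A.
  by have := RGenOInfty.measurableE R; move: mA; rewrite /measurable /= => + <-.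
have tail (Z : {RV P >-> R}) z : distribution P Z `]z, +oo[ = (1 - cdf Z z)%E.
  by rewrite /cdf -probability_setC // setCitvl.
apply: (@g_sigma_algebra_measure_unique _ _ _ (@RGenOInfty.G R) _
  (fun n : nat => `]- n%:R, +oo[%classic)) mA'.
- by move=> _ [x ->].
- by move=> n; exists (- n%:R).
- apply/seteqP; split => // x _; exists (Num.truncn `|x|).+1 => //=.
  rewrite in_itv /= andbT ltrNl; apply: le_lt_trans (ler_norm _) _.
  by rewrite normrN; apply: truncnS_gt.
- move=> _ _ [x ->] [y ->]; exists (Num.max x y).
  apply/seteqP; split => z /=; rewrite !in_itv /= !andbT gt_max.
    by case=> -> ->.
  by case/andP.
- move=> _ [z ->]; apply: etrans (tail X z) _.
  by apply: etrans (esym (tail X' z)); rewrite XX'.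
- by move=> n; apply: le_lt_trans (probability_le1 _ _) _ => //; rewrite ltry.
Qed.

(** Leaving the other variables unconstrained, by the test set [setT], embeds the
    product rule of the subfamily in that of the whole family. *)
Lemma mutually_independent_sub (I J : finType) (f : J -> I)
    (X : I -> {RV P >-> R}) : injective f ->
  mutually_independent X -> mutually_independent (fun j => X (f j)).
Proof.
move=> f_inj indX S B mB.
pose B' (i : I) : set R := if [pick j | f j == i] is Some j then B j else setT.
have B'f j : B' (f j) = B j.
  rewrite /B'; case: pickP => [j' /eqP /f_inj -> //|/(_ j)].
  by rewrite eqxx.
have mB' i : measurable (B' i) by rewrite /B'; case: pickP.
have := indX (f @: S)%SET B' mB'.
rewrite big_imset /=; last by move=> ? ? _ _; apply: f_inj.
under eq_bigr do rewrite B'f.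
move=> <-; congr (P _); apply/seteqP; split => w /= h.
  by move=> _ /= /imsetP[j jS ->]; rewrite /preimage /= B'f; apply: h.
by move=> j /= jS; have := h (f j) (imset_f f jS); rewrite /preimage /= B'f.
Qed.

Section Discretize.
Variables (I B : finType) (X : I -> {RV P >-> R}) (c : R -> B).
Hypothesis indX : mutually_independent X.
Hypothesis mc : forall b, measurable (c @^-1` [set b]).

Definition class_prob i b : R := fine (P (X i @^-1` (c @^-1` [set b]))).

Lemma measurable_class i b : measurable (X i @^-1` (c @^-1` [set b])).
Proof. exact: measurable_funPTI. Qed.

Lemma class_prob_ge0 i b : 0 <= class_prob i b.
Proof. by rewrite fine_ge0. Qed.

Let event (f : {ffun I -> B}) : set T :=
  \bigcap_(i in [set i | i \in [set: I]%SET]) (X i @^-1` (c @^-1` [set f i])).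

Let event_measurable f : measurable (event f).
Proof.
apply: fin_bigcap_measurable; first exact: finite_finset.
by move=> i _; apply: measurable_class.
Qed.

Let eventE (D : pred {ffun I -> B}) :
  [set w | D [ffun i => c (X i w)]] = \bigcup_(f in [set` D]) event f.
Proof.
apply/seteqP; split => [w Dw|w [f Df h] /=].
  by exists [ffun i => c (X i w)] => // i _; rewrite /= ffunE.
have -> : [ffun i => c (X i w)] = f; last by [].
by apply/ffunP => i; rewrite ffunE; apply: (h i); rewrite /= inE.
Qed.

Lemma measurable_discrete_event (D : pred {ffun I -> B}) :
  measurable [set w | D [ffun i => c (X i w)]].
Proof. by rewrite eventE; apply: fin_bigcup_measurable. Qed.

(** Only finitely many rectangles are involved, so the product rule alone gives
    the joint law, without any product measure. *)
Lemma discrete_law (D : pred {ffun I -> B}) :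
  fine (P [set w | D [ffun i => c (X i w)]]) =
  \sum_(f | D f) \prod_i class_prob i (f i).
Proof.
rewrite eventE measure_fin_bigcup //; last first.
  move=> f g _ _ [w [hf hg]]; apply/ffunP => i.
  by rewrite -(hf i) -?(hg i) //= inE.
rewrite (fsbigE (enum D)) ?enum_uniq //=; last 2 first.
- by move=> f /=; rewrite mem_enum.
- by move=> f Df; rewrite mem_enum => /negP[].
rewrite big_enum_cond /=.
under eq_bigr => f _.
  rewrite /event indX; last by move=> i; apply: mc.
  rewrite (eq_bigl predT); last by move=> i; rewrite inE.
  rewrite (eq_bigr (fun i => (class_prob i (f i))%:E)); last first.
    by move=> i _; rewrite fineK // fin_num_measure //; apply: measurable_class.
  rewrite prodEFin.
  over.
rewrite sumEFin /=; apply: eq_bigl => f.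
by rewrite mem_setE andbb.
Qed.

Lemma sum_class_prob i : \sum_b class_prob i b = 1.
Proof.
have <- : fine (P setT) = 1 by rewrite probability_setT.
have -> : [set: T] = \bigcup_(b in [set: B]) (X i @^-1` (c @^-1` [set b])).
  by apply/seteqP; split => // w _; exists (c (X i w)).
rewrite measure_fin_bigcup; last 3 first.
- exact: finite_finset.
- by move=> b b' _ _ [w [/= -> ->]].
- by move=> b _; apply: measurable_class.
rewrite (fsbigE (enum B)) ?enum_uniq //=; last first.
  by move=> b _; rewrite mem_enum.
rewrite big_enum_cond /=.
rewrite (eq_bigr (fun b => (class_prob i b)%:E)); last first.
  by move=> b _; rewrite fineK // fin_num_measure //; apply: measurable_class.
by rewrite sumEFin /=; apply: eq_bigl => b; rewrite mem_setT.
Qed.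

End Discretize.
End Law.

(** * The two-sample Kolmogorov-Smirnov inequality *)

(** The injection matches the enumeration of [S] followed by that of its
    complement with the corresponding one for [S']. *)
Lemma exists_inj_imset (I : finType) (S S' : {set I}) : #|S| = #|S'| ->
  exists2 s : I -> I, injective s & (s @: S)%SET = S'.
Proof.
move=> cS; pose e (A : {set I}) := enum A ++ enum (~: A)%SET.
have ue A : uniq (e A).
  rewrite cat_uniq !enum_uniq /= andbT; apply/hasPn => i.
  by rewrite /= !mem_enum inE.
have me A i : i \in e A by rewrite mem_cat !mem_enum inE orbN.
have se A : size (e A) = #|I| by rewrite size_cat -!cardE cardsC.
pose s i := nth i (e S') (index i (e S)).
have idx i : (index i (e S) < size (e S'))%N by rewrite se -(se S) index_mem.
have s_inj : injective s.
  move=> i j; rewrite /s (set_nth_default i j) // => /eqP.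
  by rewrite nth_uniq // => /eqP /(congr1 (nth i (e S))); rewrite !nth_index.
exists s => //; apply/eqP; rewrite eqEcard card_imset // cS leqnn andbT.
apply/fintype.subsetP => _ /imsetP[i iS ->].
have lt : (index i (enum S) < size (enum S'))%N.
  by rewrite -cardE -cS cardE index_mem mem_enum.
by rewrite /s /e index_cat mem_enum iS nth_cat lt -mem_enum mem_nth.
Qed.

Section Exchange.
Context (R : realType) (I B : finType) (p : B -> R).
Hypotheses (p_ge0 : forall b, 0 <= p b) (p_sum : \sum_b p b = 1).

Let weight (f : {ffun I -> B}) : R := \prod_i p (f i).

(** Relabelling i.i.d. variables by an injection leaves their joint law unchanged,
    so the events [ev S] have the same probability for all [S] of a given size.
    Summing it over these [S] and exchanging the sums leaves the number of sets
    [S] for which a fixed outcome satisfies [ev S]. *)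
Lemma exchangeable_average (ev : {set I} -> {ffun I -> B} -> bool) (S0 : {set I})
    (c : nat) :
  (forall (s : I -> I) (S : {set I}) f, injective s ->
     ev (s @: S)%SET f = ev S [ffun i => f (s i)]) ->
  (forall f, #|[set S : {set I} | (#|S| == #|S0|) && ev S f]%SET| <= c)%N ->
  ('C(#|I|, #|S0|))%:R * (\sum_(f | ev S0 f) weight f) <= c%:R.
Proof.
move=> evs cle; set q := \sum_(f | _) _.
have qS (S : {set I}) : #|S| = #|S0| -> \sum_(f | ev S f) weight f = q.
  move=> /esym/exists_inj_imset[s s_inj <-].
  pose h (f : {ffun I -> B}) : {ffun I -> B} := [ffun i => f (s i)].
  have h_inj : injective h.
    move=> f g /ffunP fg; apply/ffunP => i.
    have [s' ss' s's] := injF_bij s_inj.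
    by have := fg (s' i); rewrite !ffunE s's.
  rewrite /q [RHS](reindex_inj h_inj) /=; apply: eq_big => f; first exact: evs.
  move=> _; rewrite /weight (reindex_inj s_inj) /=.
  by apply: eq_bigr => i _; rewrite ffunE.
have <- : \sum_(S : {set I} | #|S| == #|S0|) q = 'C(#|I|, #|S0|)%:R * q.
  by rewrite sumr_const -card_draws cardsE mulr_natl.
rewrite (eq_bigr (fun S : {set I} => \sum_f (ev S f)%:R * weight f)); last first.
  move=> S /eqP /qS <-; rewrite big_mkcond /=; apply: eq_bigr => f _.
  by case: (ev S f); rewrite ?mul1r ?mul0r.
rewrite exchange_big /=.
have w1 : \sum_(f : {ffun I -> B}) weight f = 1.
  rewrite /weight -(bigA_distr_bigA (fun _ b => p b)) /=.
  by rewrite big1 // => i _; rewrite p_sum.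
have -> : c%:R = \sum_f c%:R * weight f by rewrite -mulr_sumr w1 mulr1.
apply: ler_sum => f _.
rewrite -mulr_suml ler_wpM2r ?prodr_ge0 // -natr_sum ler_nat.
apply: leq_trans (cle f).
rewrite (eq_bigr (fun S => if ev S f then 1 else 0)%N); last first.
  by move=> S _; case: (ev S f).
rewrite -big_mkcondr /=.
by rewrite sum1dep_card.
Qed.
End Exchange.

Section Bins.
Context {R : realType}.
Variables (qs : nat -> R) (M : nat).

(** The number of grid points below [x]: comparing levels decides comparisons
    with grid points ([level_le]), whether or not the grid is sorted. *)
Definition level (x : R) : nat := #|[set j : 'I_M | qs j < x]%SET|.

Lemma level_le (x : R) (j : 'I_M) : (level x <= level (qs j))%N = (x <= qs j).
Proof.
rewrite /level; case: leP => [xq|qx].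
  apply: subset_leq_card; apply/fintype.subsetP => i; rewrite !inE => /lt_le_trans.
  exact.
apply/negbTE; rewrite -ltnNge; apply: proper_card; apply/properP; split.
  by apply/fintype.subsetP => i; rewrite !inE => /lt_trans; apply.
by exists j; rewrite !inE // ltxx.
Qed.

Lemma level_lt x : (level x < M.+1)%N.
Proof. by rewrite ltnS -[leqRHS]card_ord max_card. Qed.

Definition bin (x : R) : 'I_M.+1 := Ordinal (level_lt x).

Lemma measurable_bin b : measurable (bin @^-1` [set b]).
Proof.
apply: is_interval_measurable => x y /= xb yb z /andP[xz zy].
have mono (u v : R) : u <= v -> (level u <= level v)%N.
  move=> uv; apply: subset_leq_card; apply/fintype.subsetP => i.
  by rewrite !inE => /lt_le_trans; apply.
apply: val_inj => /=; apply/eqP; rewrite eqn_leq; apply/andP; split.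
  by rewrite -yb; apply: mono.
by rewrite -xb; apply: mono.
Qed.
End Bins.

(** A finite sample lying above [z] stays above some larger real number, and a
    rational number fits in between. *)
Lemma le_ratr_approx (R : realType) (J : finType) (x : J -> R) (z : R) :
  exists q : rat, forall j, (x j <= z) = (x j <= ratr q).
Proof.
pose u := \big[Num.min/z + 1]_(j | z < x j) x j.
have zu : z < u.
  by rewrite /u; elim/big_ind: _ => [|a b|//]; [rewrite ltrDl|rewrite lt_min => -> ->].
have [q /itvP zqu] := rat_in_itvoo zu; exists q => j.
have [xz|zx] := leP (x j) z; first by rewrite (le_trans xz) // zqu.
apply/esym/negbTE; rewrite -ltNge; apply: lt_le_trans (_ : u <= _); first by rewrite zqu.
by rewrite /u (bigminD1 j) // ge_min lexx.
Qed.

Section TwoSample.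
Context d (T : measurableType d) (R : realType) (P : probability T R).
Variables (I : finType) (X : I -> {RV P >-> R}) (S0 : {set I}) (N k : nat).
Hypothesis indX : mutually_independent X.
Hypothesis sameX : forall i j z, cdf (X i) z = cdf (X j) z.
Hypotheses (N_gt0 : (0 < N)%N) (cI : #|I| = N.*2) (cS0 : #|S0| = N).

(** On finitely many levels the comparison depends only on the classes of the
    observations between levels, whose joint law is explicit; ties between
    observations are then harmless. *)
Lemma two_sample_grid (qs : nat -> R) (M : nat) :
  let E := [set w | [exists j : 'I_M,
      (k <= excess_abs (fun i => (X i w <= qs j)%R) S0)%N]] in
  measurable E /\
  fine (P E) <= 2 * expR (1 / 2 - k%:R ^+ 2 / N%:R).
Proof.
pose D (S : {set I}) (f : {ffun I -> 'I_M.+1}) := [exists j : 'I_M,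
  (k <= excess_abs (fun i => f i <= level qs M (qs j)) S)%N].
have -> /= : [set w | [exists j : 'I_M,
      (k <= excess_abs (fun i => (X i w <= qs j)%R) S0)%N]] =
    [set w | D S0 [ffun i => bin qs M (X i w)]].
  apply/seteqP; split => w /= /existsP[j h]; apply/existsP; exists j; move: h;
  rewrite (@eq_excess_abs _ (fun i => (X i w <= qs j)%R)
     (fun i => [ffun i => bin qs M (X i w)] i <= level qs M (qs j))%N) //;
  by move=> i; rewrite ffunE /= level_le.
split.
  by apply: measurable_discrete_event; apply: measurable_bin.
rewrite (discrete_law indX (@measurable_bin _ qs M)).
have [i0 _] : exists i : I, i \in [set: I]%SET.
  by apply/card_gt0P; rewrite cardsT cI double_gt0 N_gt0.
rewrite (eq_bigr (fun f : {ffun I -> 'I_M.+1} =>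
   \prod_i class_prob X (bin qs M) i0 (f i))); last first.
  move=> f _; apply: eq_bigr => i _; congr (fine _).
  by apply: eq_law; [move=> z; apply: sameX|apply: measurable_bin].
set q := \sum_(f | _) _.
have := @exchangeable_average R I _ (class_prob X (bin qs M) i0) _ _ D S0
  ('C(N.*2, N + k).*2).
rewrite cI cS0 -/q => avg.
have {}avg : 'C(N.*2, N)%:R * q <= ('C(N.*2, N + k).*2)%:R.
  apply: avg.
  - by move=> b; apply: class_prob_ge0.
  - exact: sum_class_prob (@measurable_bin _ qs M) _.
  - move=> s S f s_inj; apply: eq_existsb => j.
    rewrite excess_abs_reindex //; congr (_ <= _)%N.
    by apply: eq_excess_abs => i; rewrite ffunE.
  - by move=> f; apply: card_excess_abs_ge.
have C0 : 0 < 'C(N.*2, N)%:R :> R by rewrite ltr0n bin_gt0 -addnn leq_addr.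
rewrite -(ler_pM2l C0); apply: le_trans avg _.
(* Beyond [k = N] the binomial coefficient vanishes. *)
have [kN|Nk] := leqP k N; last first.
  by rewrite bin_small ?mulr_ge0 ?expR_ge0 //; lia.
rewrite -mul2n natrM mulrCA ler_pM2l //.
apply: le_trans (central_binomial_ratio R kN) _.
rewrite ler_wpM2l // ler_expR.
have NR : 0 < N%:R :> R by rewrite ltr0n.
have kNR : k%:R ^+ 2 <= N%:R ^+ 2 :> R by rewrite ler_sqr ?nnegrE // ler_nat.
rewrite -subr_ge0.
have -> : 1 / 2 - k%:R ^+ 2 / N%:R - - (2 * k%:R ^+ 2 / (2 * N%:R + 1)) =
    (N%:R + 2 * (N%:R ^+ 2 - k%:R ^+ 2)) / (2 * N%:R * (2 * N%:R + 1)) :> R.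
  by field; apply/andP; split; lra.
apply: divr_ge0; first lra.
by rewrite !mulr_ge0 //; lra.
Qed.

(** The finite grids exhaust the rational levels, which see every value of the
    empirical distribution functions; the bound passes to the increasing union.
    A single measurable set covers all real levels. *)
Lemma two_sample_tail :
  exists E : set T, [/\ measurable E,
    fine (P E) <= 2 * expR (1 / 2 - k%:R ^+ 2 / N%:R) &
    forall w, ~ E w ->
      forall z, (excess_abs (fun i => (X i w <= z)%R) S0 < k)%N].
Proof.
pose qs (j : nat) : R := ratr (odflt 0 (unpickle j)).
pose E (M : nat) := [set w | [exists j : 'I_M,
      (k <= excess_abs (fun i => (X i w <= qs j)%R) S0)%N]].
have mE M : measurable (E M) by have [] := two_sample_grid qs M.
have mUE : measurable (\bigcup_M E M) by apply: bigcupT_measurable.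
exists (\bigcup_M E M); split => //.
- rewrite -lee_fin fineK ?fin_num_measure //.
  have ndE : nondecreasing_seq E.
    move=> M M' MM'; apply/subsetPset => w /= /existsP[j h].
    by apply/existsP; exists (widen_ord MM' j).
  have cvgE := nondecreasing_cvg_mu (mu := P) mE mUE ndE.
  apply: (cvge_le _ cvgE); apply: nearW => M /=.
  rewrite -[X in (X <= _)%E]fineK ?fin_num_measure // lee_fin.
  by have [] := two_sample_grid qs M.
- move=> w nE z; rewrite ltnNge; apply/negP => h; apply: nE.
  have [q eq] := le_ratr_approx (fun i => X i w) z.
  exists (pickle q).+1 => //=; apply/existsP; exists ord_max => /=.
  rewrite /qs pickleK /=; move: h.
  by rewrite (@eq_excess_abs _ _ (fun i => (X i w <= ratr q)%R)).
Qed.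

End TwoSample.

(** * Deviations of a signed count at a fixed level *)

Section Chernoff.
Context d (T : measurableType d) (R : realType) (P : probability T R).
Variables (I : finType) (X : I -> {RV P >-> R}) (z : R) (G : I -> R).
Hypothesis indX : mutually_independent X.
Hypothesis cdfX : forall i, cdf (X i) z = (G i)%:E.

Let below (x : R) : bool := x <= z.

Let measurable_below b : measurable (below @^-1` [set b]).
Proof.
case: b.
  have -> : below @^-1` [set true] = `]-oo, z]%classic.
    by apply/seteqP; split => x /=; rewrite in_itv.
  exact: measurable_itv.
have -> : below @^-1` [set false] = `]z, +oo[%classic.
  apply/seteqP; split => x /=; rewrite in_itv /= andbT ltNge /below.
    by move=> ->.
  by move/negbTE.
exact: measurable_itv.
Qed.

Let class_prob_true i : class_prob X below i true = G i.
Proof.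
rewrite /class_prob -[RHS]/(fine (G i)%:E) -cdfX; congr (fine (P _)).
Qed.

Let class_prob_false i : class_prob X below i false = 1 - G i.
Proof.
have := sum_class_prob X measurable_below i; rewrite big_bool /= class_prob_true.
by move=> <-; rewrite addrC addrK || rewrite addrAC subrr add0r.
Qed.

Lemma cdf_value_ge0 i : 0 <= G i.
Proof. by rewrite -class_prob_true; apply: class_prob_ge0. Qed.

Lemma cdf_value_le1 i : G i <= 1.
Proof. by rewrite -subr_ge0 -class_prob_false; apply: class_prob_ge0. Qed.

(** Each factor of the exponential moment is at most [1 + lam^2], because
    [exp y <= 1 + y + y^2] for [y <= 1/3] and the centred variables have absolute
    value at most [1]. *)
Lemma chernoff (a : I -> R) (t lam : R) :
  (forall i, `|a i| <= 1) -> 0 <= lam <= 1 / 3 ->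
  let E := [set w | t <= \sum_i a i * ((X i w <= z)%R%:R - G i)] in
  measurable E /\ fine (P E) <= expR (lam ^+ 2 * #|I|%:R - lam * t).
Proof.
move=> a1 /andP[lam0 lam3].
pose D (f : {ffun I -> bool}) := t <= \sum_i a i * ((f i)%:R - G i).
have DE w : D [ffun i => below (X i w)] =
    (t <= \sum_i a i * ((X i w <= z)%R%:R - G i)).
  by rewrite /D; congr (_ <= _); apply: eq_bigr => i _; rewrite ffunE.
have -> /= : [set w | t <= \sum_i a i * ((X i w <= z)%R%:R - G i)] =
    [set w | D [ffun i => below (X i w)]].
  by apply/seteqP; split => w /=; rewrite DE.
split; first exact: measurable_discrete_event.
rewrite (discrete_law indX measurable_below).
pose y i (b : bool) := lam * (a i * (b%:R - G i)).
have yE f : D f -> 1 <= expR (- (lam * t)) * \prod_i expR (y i (f i)).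
  move=> Df; rewrite -expR_sum -expRD -expR0 ler_expR addrC subr_ge0.
  by rewrite -mulr_sumr ler_wpM2l.
have w0 f : 0 <= \prod_i class_prob X below i (f i) 
  by apply: prodr_ge0 => i _; apply: class_prob_ge0.
apply: (@le_trans _ _ (expR (- (lam * t)) *
    \sum_(f : {ffun I -> bool}) \prod_i (class_prob X below i (f i) * expR (y i (f i))))).
  rewrite mulr_sumr big_mkcond /=; apply: ler_sum => f _.
  rewrite big_split /= mulrCA; case: ifP => [/yE h|_].
    by rewrite -[leLHS]mulr1 ler_wpM2l.
  by rewrite mulr_ge0 ?mulr_ge0 ?expR_ge0 // prodr_ge0 // => i _; apply: expR_ge0.
rewrite -(bigA_distr_bigA (fun i b => class_prob X below i b * expR (y i b))) /=.
rewrite addrC expRD ler_wpM2l ?expR_ge0 //.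
have -> : expR (lam ^+ 2 * #|I|%:R) = \prod_(i : I) expR (lam ^+ 2).
  by rewrite -expR_sum sumr_const mulr_natr.
apply: ler_prod => i _; apply/andP; split.
  by apply: sumr_ge0 => b _; rewrite mulr_ge0 ?expR_ge0 ?class_prob_ge0.
rewrite big_bool /= class_prob_true class_prob_false.
have G0 := cdf_value_ge0 i; have G1 := cdf_value_le1 i.
have /ler_normlP[ai1 ai2] := a1 i.
have aG (b : bool) : `|a i * (b%:R - G i)| <= 1.
  rewrite normrM mulr_ile1 //; rewrite ler_norml; case: b => /=; lra.
have ylam b : `|y i b| <= lam by rewrite normrM ger0_norm // ler_piMr.
have yexp b : expR (y i b) <= 1 + y i b + lam ^+ 2.
  apply: le_trans (expR_le_quadratic _) _.
    by apply: le_trans (ler_norm _) _; apply: le_trans (ylam b) _.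
  by rewrite lerD2l -real_normK ?num_real // ler_pXn2r ?nnegrE.
apply: (@le_trans _ _ (1 + lam ^+ 2)); last exact: expR_ge1Dx.
apply: (@le_trans _ _ (G i * (1 + y i true + lam ^+ 2) +
                       (1 - G i) * (1 + y i false + lam ^+ 2))).
  by apply: lerD; apply: ler_wpM2l => //; lra.
by rewrite /y /= le_eqVlt; apply/orP; left; apply/eqP; ring.
Qed.

Lemma signed_deviation_tail (S0 : {set I}) (N : nat) (s : R) :
  #|I| = N.*2 -> 0 <= s <= 1 ->
  exists E : set T, [/\ measurable E,
    fine (P E) <= 2 * expR (- (N%:R * s ^+ 2 / 8)) &
    forall w, ~ E w ->
      `|\sum_i (-1) ^+ (i \notin S0) * ((X i w <= z)%R%:R - G i)| < N%:R * s].
Proof.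
move=> cI /andP[s0 s1]; pose a i : R := (-1) ^+ (i \notin S0).
have na b i : `|(-1) ^+ b * a i| <= 1 by rewrite normrM !normr_sign mulr1.
(* [lam = s / 4] minimizes [2 N lam^2 - lam N s]. *)
have lam : 0 <= s / 4 <= 1 / 3 by lra.
pose E (b : bool) := [set w |
  N%:R * s <= \sum_i ((-1) ^+ b * a i) * ((X i w <= z)%R%:R - G i)].
have [mE PE] : (forall b, measurable (E b)) /\
    (forall b, fine (P (E b)) <= expR (- (N%:R * s ^+ 2 / 8))).
  split=> b; have [h1 h] := chernoff (N%:R * s) (na b) lam; first exact: h1.
  apply: le_trans h _; rewrite ler_expR cI -mul2n natrM.
  by rewrite le_eqVlt; apply/orP; left; apply/eqP; field.
have PE' b : (P (E b) <= (expR (- (N%:R * s ^+ 2 / 8)))%:E)%E.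
  by rewrite -(@fineK _ (P (E b))) ?fin_num_measure // lee_fin.
exists (E true `|` E false); split; first exact: measurableU.
- rewrite -lee_fin fineK ?fin_num_measure //; last exact: measurableU.
  apply: le_trans (measureU2 _ _ _) _ => //.
  rewrite mulr_natl mulr2n EFinD.
  by apply: leeD; apply: PE'.
- move=> w nE; rewrite ltNge; apply/negP; rewrite ler_normr => h; apply: nE.
  case/orP: h => h; [right|left]; rewrite /E /=.
    by under eq_bigr do rewrite expr0 mul1r.
  under eq_bigr do rewrite expr1 mulN1r mulNr.
  by rewrite sumrN.
Qed.
End Chernoff.

(** * The CUSUM statistic as a signed sum over its window *)

(** The two truncated differences are the positive and the negative part of the
    signed sum. *)
Lemma excess_abs_signed (R : realType) (I : finType) (Q : pred I) (S : {set I}) :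
  (excess_abs Q S)%:R =
  `|\sum_i (-1) ^+ (i \notin S) * (Q i)%:R| :> R.
Proof.
pose A := #|[set i in S | Q i]%SET|; pose B := #|[set i in (~: S) | Q i]%SET|.
have -> : \sum_i (-1) ^+ (i \notin S) * (Q i)%:R = A%:R - B%:R :> R.
  have cE (C : {set I}) :
      #|[set i in C | Q i]%SET|%:R = \sum_i ((i \in C) && Q i)%:R :> R.
    rewrite -sum1dep_card natr_sum big_mkcond; apply: eq_bigr => i _.
    by case: (_ && _).
  rewrite /A /B !cE -sumrB; apply: eq_bigr => i _; rewrite !inE.
  by case: (i \in S); case: (Q i) => /=; rewrite ?expr0 ?expr1; ring.
rewrite /excess_abs /excess finset.setCK -/A -/B.
have [AB|BA] := leqP A B.
  rewrite (_ : maxn _ _ = B - A)%N; last by lia.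
  by rewrite natrB // distrC ger0_norm // subr_ge0 ler_nat.
rewrite (_ : maxn _ _ = A - B)%N; last by lia.
by rewrite natrB ?(ltnW BA) // ger0_norm // subr_ge0 ler_nat ltnW.
Qed.

Section Window.
Variables (m l r : nat).
Hypotheses (r_gt0 : (0 < r)%N) (rl : (r < l)%N).

(** An observation of the window is given by its half ([true] for the right one),
    its rank in that half, and its place in the sample taken at that time. *)
Definition window : finType := ((bool * 'I_r) * 'I_m)%type.

(** The predecessor of the time of an observation, since times start at [1] and
    the independent family of the model is indexed from [0]. *)
Definition pred_time (w : window) : nat := (l - r).-1 + w.1.1 * r + w.1.2.

Definition right_half : {set window} := [set w | w.1.1]%SET.

Lemma card_window : #|window| = (m * r).*2.
Proof. by rewrite !card_prod card_bool !card_ord -mul2n -mulnA [(r * m)%N]mulnC. Qed.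

Lemma card_right_half : #|right_half| = (m * r)%N.
Proof.
apply/eqP; rewrite -(eqn_pmul2l (isT : (0 < 2)%N)) mul2n -addnn; apply/eqP.
rewrite mul2n -card_window -[RHS](cardsC right_half); congr (_ + _)%N.
pose f (w : window) : window := ((~~ w.1.1, w.1.2), w.2).
have fK : involutive f by move=> [[b s] i]; rewrite /f /= negbK.
rewrite -(card_imset _ (inv_inj fK)); apply: eq_card => w.
rewrite -[w]fK mem_imset ?(inv_inj fK) //; last exact: inv_inj.
by rewrite !inE /f /=; case: (w.1.1).
Qed.

Lemma sum_window (R : realType) (g : nat -> 'I_m -> R) :
  \sum_(w : window) (-1) ^+ (w \notin right_half) * g (pred_time w).+1 w.2 =
  \sum_(l <= t < l + r) \sum_i g t i - \sum_(l - r <= t < l) \sum_i g t i.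
Proof.
have sumE (h : window -> R) :
    \sum_w h w = \sum_(b : bool) \sum_(s < r) \sum_(i < m) h ((b, s), i).
  transitivity (\sum_(q : bool * 'I_r) \sum_(i < m) h (q, i)).
    by rewrite pair_bigA; apply: eq_bigr => -[].
  by rewrite (pair_bigA _ (fun b s => \sum_(i < m) h ((b, s), i))); apply: eq_bigr => -[].
rewrite sumE.
rewrite big_bool /=; congr (_ + _).
  rewrite -{1}[l]add0n big_addn addKn big_mkord; apply: eq_bigr => s _.
  apply: eq_bigr => i _; rewrite inE /= mul1r /pred_time /=; congr (g _ i).
  by lia.
rewrite -sumrN -{1}[(l - r)%N]add0n big_addn (_ : l - (l - r) = r)%N; last by lia.
rewrite big_mkord; apply: eq_bigr => s _.
rewrite -sumrN; apply: eq_bigr => i _.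
rewrite inE /= expr1 mulN1r /pred_time /=; congr (- g _ i); lia.
Qed.

Lemma cusum_window (R : realType) (y : nat -> 'I_m -> R) z :
  cusum y l r z = (m * r)%:R^-1 * \sum_(w : window)
    (-1) ^+ (w \notin right_half) * (y (pred_time w).+1 w.2 <= z)%R%:R.
Proof.
rewrite (sum_window (fun t i => (y t i <= z)%R%:R)) /cusum /ecdf.
by rewrite -!mulr_sumr -mulrBr mulrA natrM invfM mulrC [r%:R^-1 * _]mulrC mulrC.
Qed.

End Window.

(** * Probability of a false alarm and deviation of the statistic *)

Section Supnorm.
Variable R : realType.
Implicit Types f : R -> R.

Lemma supnorm_le f c : (forall z, `|f z| <= c) -> supnorm f <= c.
Proof.
move=> fc; apply: ge_sup; first by exists `|f 0|, 0.
by move=> _ [z _ <-].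
Qed.

Lemma le_supnorm f c z : (forall z, `|f z| <= c) -> `|f z| <= supnorm f.
Proof.
move=> fc; apply: ub_le_sup; last by exists z.
by exists c => _ [u _ <-].
Qed.

Lemma supnorm_gt f c : c < supnorm f -> exists z, c < `|f z|.
Proof.
move=> /sup_gt[|_ [z _ <-] h]; last by exists z.
by exists `|f 0|, 0.
Qed.

Lemma supnorm_ge0 f c : (forall z, `|f z| <= c) -> 0 <= supnorm f.
Proof. by move=> fc; apply: le_trans (le_supnorm 0 fc). Qed.

End Supnorm.

Section ModelEvents.
Context d (T : measurableType d) (R : realType) (P : probability T R).
Variables (n m : nat) (Y : nat -> 'I_m -> {RV P >-> R}).
Variables (F : nat -> R -> R) (K : nat) (tau : nat -> nat).
Hypothesis model : univariate_model n Y F K tau.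
Hypothesis m_gt0 : (0 < m)%N.

Section OneWindow.
Variables (l r : nat).
Hypotheses (r_gt0 : (0 < r)%N) (rl : (r < l)%N) (lrn : (l + r <= n.+1)%N).

Lemma pred_time_lt (w : window m r) : (pred_time l w < n)%N.
Proof.
rewrite /pred_time; have := ltn_ord w.1.2.
by case: (w.1.1) => /=; lia.
Qed.

Definition window_sample (w : window m r) : {RV P >-> R} :=
  Y (pred_time l w).+1 w.2.

Lemma window_sample_indep : mutually_independent window_sample.
Proof.
pose f (w : window m r) : 'I_n * 'I_m := (Ordinal (pred_time_lt w), w.2).
have f_inj : injective f.
  move=> [[b s] i] [[b' s'] i'] [+ ->]; rewrite /pred_time /= => e.
  have [bb ss] : b = b' /\ s = s' :> nat.
    by have := ltn_ord s; have := ltn_ord s'; move: e; case: b; case: b' => /=; split => //; lia.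
  by rewrite bb (val_inj ss).
exact: mutually_independent_sub f_inj (model_indep model).
Qed.

Lemma window_sample_cdf w z :
  cdf (window_sample w) z = (F (pred_time l w).+1 z)%:E.
Proof. by apply: (model_cdf model); rewrite /= pred_time_lt. Qed.

Definition mean_cusum z : R :=
  r%:R^-1 * (\sum_(l <= t < l + r) F t z - \sum_(l - r <= t < l) F t z).

Let mr_gt0 : 0 < (m * r)%:R :> R. Proof. by rewrite ltr0n muln_gt0 m_gt0. Qed.

Lemma mean_cusum_window z : mean_cusum z = (m * r)%:R^-1 *
  \sum_(w : window m r) (-1) ^+ (w \notin right_half m r) *
     F (pred_time l w).+1 z.
Proof.
rewrite (sum_window r_gt0 rl (fun t (_ : 'I_m) => F t z)) /mean_cusum.
under [X in _ = _ * (X - _)]eq_bigr do rewrite sumr_const card_ord -mulr_natl.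
under [X in _ = _ * (_ - X)]eq_bigr do rewrite sumr_const card_ord -mulr_natl.
rewrite -!mulr_sumr -mulrBr mulrA; congr (_ * _).
by rewrite natrM; field; rewrite !pnatr_eq0 -!lt0n m_gt0 r_gt0.
Qed.

Lemma cusum_deviation (z s : R) : 0 <= s <= 1 ->
  exists E : set T, [/\ measurable E,
    fine (P E) <= 2 * expR (- ((m * r)%:R * s ^+ 2 / 8)) &
    forall w, ~ E w ->
      `|cusum (fun t i => Y t i w) l r z - mean_cusum z| < s].
Proof.
move=> s01.
have [E [mE PE Es]] := signed_deviation_tail window_sample_indep
   (window_sample_cdf ^~ z) (right_half m r) (card_window m r) s01.
exists E; split=> // w nE.
rewrite (cusum_window r_gt0 rl) mean_cusum_window -mulrBr normrM.
rewrite gtr0_norm ?invr_gt0 // mulrC ltr_pdivrMr // mulrC.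
apply: le_lt_trans (Es _ nE); rewrite -sumrB.
by under eq_bigr do rewrite -mulrBr.
Qed.

Lemma cusum_le1 (y : nat -> 'I_m -> R) z : `|cusum y l r z| <= 1.
Proof.
rewrite (cusum_window r_gt0 rl) normrM gtr0_norm ?invr_gt0 //.
rewrite ler_pdivrMl // mulr1 -excess_abs_signed ler_nat.
rewrite /excess_abs /excess finset.setCK geq_max.
have h (A : {set window m r}) (Q : pred _) :
    (#|A| = m * r -> #|[set i in A | Q i]%SET| <= m * r)%N.
  by move=> <-; apply: subset_leq_card; apply/fintype.subsetP => i; rewrite inE => /andP[].
have cC : #|(~: right_half m r)%SET| = (m * r)%N.
  by have := cardsC (right_half m r); rewrite card_right_half card_window; lia.
by apply/andP; split; apply: leq_trans (leq_subr _ _) _; apply: h => //; apply: card_right_half.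
Qed.

(** The statistic takes values in the multiples of [1 / (m r)], so the threshold
    may be replaced by the least such multiple above it.  With
    [L = ln (4 n / (delta r))], the tail is [2 exp (1/2 - 2 L) <= 4 exp (- 2 L)]. *)
Lemma null_test_tail (delta : R) : 0 < delta < 1 -> (2 * r <= n)%N ->
  (forall t, (l - r <= t < l + r)%N -> F t = F l) ->
  exists E : set T, [/\ measurable E,
    fine (P E) <= (delta * r%:R / (2 * n%:R)) ^+ 2 &
    forall w, ~ E w -> ~~ test n delta (fun t i => Y t i w) l r].
Proof.
move=> /andP[delta0 delta1] rn Fconst.
have rR : 0 < r%:R :> R by rewrite ltr0n.
have nR : 0 < n%:R :> R by rewrite ltr0n; lia.
set thr := threshold n m delta r.
have thr0 : 0 <= thr by apply: sqrtr_ge0.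
have [k0 kP kmin] : exists2 k : nat, (m * r)%:R * thr <= k%:R &
    forall k', (m * r)%:R * thr <= k'%:R -> (k <= k')%N.
  have ex : exists k : nat, (m * r)%:R * thr <= k%:R.
    by exists (Num.bound ((m * r)%:R * thr)); apply/ltW/archi_boundP; rewrite mulr_ge0 // ltW.
  by exists (ex_minn ex); case: ex_minnP.
have same (v w : window m r) z : cdf (window_sample v) z = cdf (window_sample w) z.
  have in_w (u : window m r) : (l - r <= (pred_time l u).+1 < l + r)%N.
    by rewrite /pred_time; have := ltn_ord u.1.2; case: (u.1.1) => /=; lia.
  by rewrite !window_sample_cdf !Fconst.
have mr : (0 < m * r)%N by rewrite muln_gt0 m_gt0.
have [E [mE PE Ek]] := two_sample_tail k0 window_sample_indep same mr
  (card_window m r) (card_right_half m r).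
exists E; split => //.
- apply: le_trans PE _.
  set L := ln (4 * n%:R / (delta * r%:R)).
  have q1 : 1 <= 4 * n%:R / (delta * r%:R).
    rewrite ler_pdivlMr ?mul1r ?mulr_gt0 //.
    have : 2 * r%:R <= n%:R :> R by rewrite -natrM ler_nat.
    by have : delta * r%:R <= r%:R by [rewrite ger_pMl // ltW]; lra.
  have L0 : 0 <= L by apply: ln_ge0.
  have kL : 2 * L <= k0%:R ^+ 2 / (m * r)%:R.
    rewrite ler_pdivlMr //.
    have : ((m * r)%:R * thr) ^+ 2 <= k0%:R ^+ 2.
      have x0 : 0 <= (m * r)%:R * thr by apply: mulr_ge0 => //; apply: ltW.
      by apply: lerXn2r => //; rewrite nnegrE.
    have thrE : thr ^+ 2 = 2 * (L / (m * r)%:R).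
      rewrite /thr /threshold sqr_sqrtr -/L ?natrM //.
      by rewrite mulr_ge0 // divr_ge0 // mulr_ge0.
    rewrite exprMn thrE; apply: le_trans; move: mr_gt0; move: (_%:R) => N' N'0.
    by rewrite le_eqVlt; apply/orP; left; apply/eqP; field; rewrite gt_eqF.
  have half := expR_half_le2 R.
  have expL : expR (- L) = delta * r%:R / (4 * n%:R).
    by rewrite expRN lnK ?posrE ?(lt_le_trans _ q1) // invf_div.
  have -> : (delta * r%:R / (2 * n%:R)) ^+ 2 = 2 * (2 * (expR (- L)) ^+ 2).
    by rewrite expL; field; rewrite gt_eqF.
  rewrite ler_pM2l // -expRM_natl expRD ler_pM ?expR_ge0 // ler_expR.
  lra.
(* Every value is at most [(k0 - 1) / (m r)], which is below the threshold by
   minimality of [k0]. *)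
- move=> w /Ek lt_k; rewrite /test -ltNge -/thr.
  have [k_eq0|k_gt0] := posnP k0; first by have := lt_k 0; rewrite k_eq0.
  have lt_thr : (k0.-1)%:R / (m * r)%:R < thr.
    rewrite ltr_pdivrMr // mulrC ltNge; apply/negP => /kmin; lia.
  apply: le_lt_trans lt_thr; apply: supnorm_le => z.
  rewrite (cusum_window r_gt0 rl) normrM gtr0_norm ?invr_gt0 // mulrC.
  by rewrite ler_pM2r ?invr_gt0 // -excess_abs_signed ler_nat -ltnS prednK.
Qed.

End OneWindow.
End ModelEvents.

(** * Closed sets of reals, change-points and grid locations *)

Section ClosedBounded.
Variable R : realType.
Implicit Types C : set R.

Lemma closed_sup_mem C : C !=set0 -> has_ubound C -> closed C -> C (sup C).
Proof.
by move=> C0 ubC /closure_id clC; rewrite [X in X _]clC; apply: closure_sup.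
Qed.

Lemma closed_inf_mem C : C !=set0 -> has_lbound C -> closed C -> C (inf C).
Proof.
move=> [x Cx] [b lbC] clC.
have CN : -%R @` C = -%R @^-1` C.
  apply/seteqP; split => [_ [u Cu <-]|u Cu] /=; first by rewrite opprK.
  by exists (- u); rewrite ?opprK.
have : (-%R @` C) (sup (-%R @` C)).
  apply: closed_sup_mem.
  - by exists (- x), x.
  - by exists (- b) => _ [u Cu <-]; rewrite lerN2; apply: lbC.
  - rewrite CN; apply: closed_comp => // u _; exact: opp_continuous.
by rewrite {1}CN.
Qed.

End ClosedBounded.

Section ChangePointTimes.
Variables (K : nat) (tau : nat -> nat).
Hypothesis tau_incr : forall k, (k <= K)%N -> (tau k < tau k.+1)%N.

Lemma tau_le i j : (i <= j <= K.+1)%N -> (tau i <= tau j)%N.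
Proof.
move=> /andP[/subnKC <-]; elim: (j - i)%N => [|h IHh]; first by rewrite addn0.
rewrite addnS ltnS => hK; have := tau_incr hK; have := IHh (leqW hK); lia.
Qed.

Lemma tau_lt i j : (i < j <= K.+1)%N -> (tau i < tau j)%N.
Proof.
move=> /andP[ij jK]; have iK : (i <= K)%N by lia.
by have := tau_incr iK; have := @tau_le i.+1 j; rewrite ij jK => /(_ isT); lia.
Qed.

Lemma segment_radius_sep i k : (1 <= i <= K)%N -> (1 <= k <= K)%N -> i != k ->
  (tau i + segment_radius tau k <= tau k)%N \/
  (tau k + segment_radius tau k <= tau i)%N.
Proof.
move=> iK kK; rewrite /segment_radius neq_ltn => /orP[ik|ki]; [left|right].
  have h1 : (tau i <= tau k.-1)%N by apply: tau_le; lia.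
  have h2 : (tau k.-1 < tau k)%N by apply: tau_lt; lia.
  by have := geq_minr (tau k.+1 - tau k) (tau k - tau k.-1); lia.
have h1 : (tau k.+1 <= tau i)%N by apply: tau_le; lia.
have h2 : (tau k < tau k.+1)%N by apply: tau_lt; lia.
by have := geq_minl (tau k.+1 - tau k) (tau k - tau k.-1); lia.
Qed.

Lemma segment_radius_gt0 k : (1 <= k <= K)%N -> (0 < segment_radius tau k)%N.
Proof.
move=> kK; have h2 : (tau k.-1 < tau k)%N by apply: tau_lt; lia.
have h3 : (tau k < tau k.+1)%N by apply: tau_lt; lia.
by rewrite /segment_radius leq_min; lia.
Qed.

Lemma segment_radius_half n k : tau 0%N = 1%N -> tau K.+1 = n.+1 ->
  (1 <= k <= K)%N -> (2 * segment_radius tau k <= n)%N.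
Proof.
move=> tau0 tauK kK; have h1 : (tau k.+1 <= tau K.+1)%N by apply: tau_le; lia.
have h0 : (tau 0 <= tau k.-1)%N by apply: tau_le; lia.
have h2 : (tau k.-1 < tau k)%N by apply: tau_lt; lia.
have h3 : (tau k < tau k.+1)%N by apply: tau_lt; lia.
have := geq_minl (tau k.+1 - tau k) (tau k - tau k.-1).
have := geq_minr (tau k.+1 - tau k) (tau k - tau k.-1).
by rewrite -/(segment_radius tau k); lia.
Qed.
End ChangePointTimes.

Lemma scale_le n j : (0 < n)%N -> (j < scale_count n)%N -> (2 * 2 ^ j <= n)%N.
Proof.
move=> n0 jn; rewrite -expnS; apply: leq_trans (leq_pexp2l _ jn) _ => //.
exact: trunc_logP.
Qed.

Lemma locations_bounds n j l : (0 < n)%N -> (j < scale_count n)%N ->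
  locations n (2 ^ j) l -> (2 ^ j < l)%N /\ (l + 2 ^ j <= n.+1)%N.
Proof.
move=> n0 /(scale_le n0) jn; rewrite /locations.
case: j jn => [|j] /= jn; first by rewrite expn0; lia.
have r0 : (0 < 2 ^ j)%N by rewrite expn_gt0.
have -> : (2 ^ j.+1 == 1)%N = false by rewrite expnS; lia.
rewrite expnS mulKn //.
have h : (2 * n %/ (2 * 2 ^ j) * (2 ^ j) <= n)%N.
  by have := leq_trunc_div (2 * n) (2 * 2 ^ j); lia.
rewrite expnS in jn.
case=> [[q /= /andP[q2 qn] <-]|->]; last by lia.
have := leq_mul q2 (leqnn (2 ^ j)); have := leq_mul qn (leqnn (2 ^ j)).
by rewrite mulnBl; split; lia.
Qed.

(** * The estimator on a fixed sample *)

Lemma test_interval_nat (R : realType) (l r a : nat) :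
  (test_interval l r : set R) a%:R <-> ((l < a + r) && (a < l + r))%N.
Proof.
rewrite /test_interval /= in_itv /=.
have -> : (l%:R - r%:R + 1 <= a%:R :> R) = (l < a + r)%N.
  by rewrite -addn1 -(ler_nat R) !natrD; apply/idP/idP; lra.
have -> : (a%:R <= l%:R + r%:R - 1 :> R) = (a < l + r)%N.
  by rewrite -addn1 -(ler_nat R) !natrD; apply/idP/idP; lra.
by [].
Qed.

Section Components.
Context {R : realType} (n m : nat) (delta : R) (y : nat -> 'I_m -> R).
Hypothesis n_gt0 : (0 < n)%N.

Let J := scale_count n.
Let cov j := covered n delta y j.
Let sel j l := selected n delta y (2 ^ j) (cov j) l.
Let box j l : set R := test_interval l (2 ^ j).

Lemma coveredP j x : cov j x <->
  exists i l, [/\ (i < j)%N, sel i l & box i l x].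
Proof.
elim: j => [|j IHj]; first by split => // -[i [l []]].
split => [[/IHj[i [l [ij sl xl]]]|[l sl xl]]|[i [l [ij sl xl]]]].
- by exists i, l; split => //; apply: ltnW.
- by exists j, l.
- have [ij'|ij'] := ltnP i j; first by left; apply/IHj; exists i, l.
  have eij : i = j by apply/eqP; rewrite eqn_leq ij' -ltnS ij.
  by right; exists l; rewrite -eij.
Qed.

(** An interval is selected only if it misses all those of smaller scales. *)
Lemma same_scale i l i' l' x :
  sel i l -> sel i' l' -> box i l x -> box i' l' x -> i = i'.
Proof.
wlog ii : i l i' l' / (i < i')%N => [th sl sl' xl xl'|].
  have [ii|ii|//] := ltngtP i i'; first exact: th sl sl' xl xl'.
  by apply/esym; apply: th sl' sl xl' xl.
move=> sl [_ _ disj] xl xl'; exfalso.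
suff : (box i' l' `&` cov i') x by rewrite /box /cov disj.
by split => //; apply/coveredP; exists i, l.
Qed.

(** Unions of selected intervals, restricted by a condition on scale and location:
    splitting the covered region in two closed parts isolates components. *)
Definition boxes (Q : nat -> nat -> Prop) : set R :=
  \bigcup_(q in [set q : nat * nat | [/\ (q.1 < J)%N, sel q.1 q.2 & Q q.1 q.2]])
    box q.1 q.2.

Lemma closed_boxes Q : closed (boxes Q).
Proof.
apply: closed_bigcup => [|q _]; last exact: interval_closed.
apply: (@sub_finite_set _ _ (`I_J `*` `I_n.+2)); last exact: finite_setX.
move=> [j l] /= [jJ [loc _ _] _]; split => //=.
by have [] := locations_bounds n_gt0 jJ loc; lia.
Qed.

Lemma coveredE : cov J = boxes (fun _ _ => True).
Proof.
apply/seteqP; split => x; first by move=> /coveredP[j [l [jJ sl xl]]]; exists (j, l).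
by move=> [[j l] [/= jJ sl _] xl]; apply/coveredP; exists j, l.
Qed.

Variables (K : nat) (tau : nat -> nat).
Hypotheses (tau0 : tau 0%N = 1%N) (tauK : tau K.+1 = n.+1).
Hypothesis tau_incr : forall k, (k <= K)%N -> (tau k < tau k.+1)%N.
Hypothesis hit : forall j l, (j < J)%N -> sel j l ->
  exists2 k, (1 <= k <= K)%N & box j l (tau k)%:R.

(** The component of a point contains the selected interval covering that point,
    and therefore the change-point hit by this interval. *)
Lemma component_props C : components n delta y C ->
  [/\ C (inf C), C (sup C), 2 <= inf C /\ sup C <= n%:R,
      is_interval C /\ (forall x, C x -> inf C <= x <= sup C) &
      exists2 k, (1 <= k <= K)%N & C (tau k)%:R].
Proof.
move=> [x0 cx0 <-]; set C' := connected_component _ _.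
have clC : closed C'.
  by apply: component_closed; rewrite -/(cov J) coveredE; apply: closed_boxes.
have C0 : C' x0 by apply: connected_component_refl.
have Csub x : C' x -> 2 <= x <= n%:R.
  move=> /connected_component_sub /coveredP[j [l [jJ [loc _ _]]]].
  have [h1 h2] := locations_bounds n_gt0 jJ loc.
  rewrite /box /test_interval /= in_itv /= => /andP[a b].
  move: h1 h2; rewrite -addn1 -(ler_nat R) natrD => h1.
  by rewrite -[n.+1]addn1 -(ler_nat R) !natrD => h2; apply/andP; split; lra.
have hlb : has_lbound C' by exists 2 => x /Csub /andP[].
have hub : has_ubound C' by exists n%:R => x /Csub /andP[].
split.
- by apply: closed_inf_mem => //; exists x0.
- by apply: closed_sup_mem => //; exists x0.
- split; first by apply: lb_le_inf; [exists x0|move=> x /Csub /andP[]].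
  by apply: ge_sup; [exists x0|move=> x /Csub /andP[]].
- split; first by apply/connected_intervalP; apply: component_connected.
  by move=> x Cx; rewrite ge_inf //= ub_le_sup.
- have [j [l [jJ sl xl]]] := (coveredP _ _).1 cx0.
  have [k kK kl] := hit jJ sl; exists k => //.
  apply: (connected_component_max (B := box j l)) => //.
  - by move=> x xl'; apply/coveredP; exists j, l.
  - by apply/connected_intervalP; apply: interval_is_interval.
Qed.

(** A component [C] is an interval with a change-point [tau_j] in it.  If
    its midpoint lies in the cell of [tau_k] with, say, [k < j], then
    [sup C >= tau_(k+1)], so by symmetry about the midpoint [inf C <= tau_k]. *)
Lemma no_spurious_components : no_spurious (components n delta y) (@midpoint R) K tau.
Proof.
have Kpos C : components n delta y C -> (0 < K)%N.
  by case/component_props => _ _ _ _ [k kK _]; lia.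
rewrite /no_spurious; case EK : K => [|K'].
  by rewrite -subset0 => C /Kpos; rewrite EK.
rewrite -EK; split.
  move=> k kK.
  suff has_tau C : components n delta y C -> midpoint C \in cell tau k -> C (tau k)%:R.
    move=> C C' CC CC' /(has_tau _ CC) tC /(has_tau _ CC') tC'.
    case: CC CC' tC tC' => x _ <- [x' _ <-] /same_connected_component -> .
    by move=> /same_connected_component ->.
  move=> CC; have [Ci Cs [i2 sn] [itvC Cb] [j jK Cj]] := component_props CC.
  rewrite inE /cell /= in_itv /= /left_end /right_end /midpoint => /andP[lo hi].
  have [->//|jk] := eqVneq k j.
  have prev : (tau k.-1)%:R + 1 <= (tau k)%:R :> R.
    rewrite natr1 ler_nat; apply: (tau_lt tau_incr); lia.
  have next : (tau k)%:R + 1 <= (tau k.+1)%:R :> R.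
    rewrite natr1 ler_nat; apply: (tau_lt tau_incr); lia.
  have /andP[ij js] := Cb _ Cj.
  apply: (itvC _ _ Ci Cs); move: jk; rewrite neq_ltn => /orP[kj|jk].
    have h : (tau k.+1)%:R <= (tau j)%:R :> R.
      rewrite ler_nat; apply: (tau_le tau_incr); lia.
    by apply/andP; split; lra.
  have h : (tau j)%:R <= (tau k.-1)%:R :> R.
    rewrite ler_nat; apply: (tau_le tau_incr); lia.
  by apply/andP; split; lra.
move=> C CC; have [Ci Cs [i2 sn] [itvC Cb] [j jK Cj]] := component_props CC.
have /andP[ij js] := Cb _ Cj.
rewrite /left_end /right_end /midpoint.
have h1 : (tau 1)%:R <= (tau j)%:R :> R by rewrite ler_nat; apply: (tau_le tau_incr); lia.
have h2 : (tau j)%:R <= (tau K)%:R :> R by rewrite ler_nat; apply: (tau_le tau_incr); lia.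
rewrite /= tau0 tauK -[n.+1%:R]natr1.
by apply/andP; split; lra.
Qed.

(** By [only_k], a selected interval of scale at most [2 ^ j] meeting one that
    contains [tau_k] contains [tau_k] too, as two such intervals are too short to
    lead to another change-point.  Hence the intervals that contain [tau_k] and
    those that do not split the covered region in two disjoint closed sets. *)
Lemma detection k j l : (1 <= k <= K)%N -> (j < J)%N ->
  locations n (2 ^ j) l -> test n delta y l (2 ^ j) -> box j l (tau k)%:R ->
  (4 * (2 ^ j).-1 < segment_radius tau k)%N ->
  exists2 C, components n delta y C &
    `|midpoint C - (tau k)%:R| <= (2 ^ j).-1%:R.
Proof.
move=> kK jJ loc tst tk rad.
have only_k i i' l' l'' x : (i <= j)%N -> (i' <= j)%N -> box i l'' x ->
    box i l'' (tau k)%:R -> (i' < J)%N -> sel i' l' -> box i' l' x ->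
    box i' l' (tau k)%:R.
  move=> ij i'j xl'' kl'' i'J sl' xl'; have [a aK al'] := hit i'J sl'.
  have [<-//|ak] := eqVneq a k.
  exfalso; have := segment_radius_sep tau_incr aK kK ak.
  have pi : (0 < 2 ^ i)%N by rewrite expn_gt0.
  have pi' : (0 < 2 ^ i')%N by rewrite expn_gt0.
  have ri : (2 ^ i <= 2 ^ j)%N by rewrite leq_pexp2l.
  have ri' : (2 ^ i' <= 2 ^ j)%N by rewrite leq_pexp2l.
  move: xl'' kl'' xl' al'; rewrite /box /test_interval /= !in_itv /=.
  move: rad ri ri' pi pi' => rad ri ri' pi pi'.
  have radR : 4 * (2 ^ j)%:R - 3 <= (segment_radius tau k)%:R :> R.
    have : (4 * 2 ^ j <= segment_radius tau k + 3)%N by lia.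
    by rewrite -(ler_nat R) natrM natrD; lra.
  move: ri ri'; rewrite -!(ler_nat R) !natrD => ri ri'.
  move=> /andP[? ?] /andP[? ?] /andP[? ?] /andP[? ?] [] ?; lra.
have [i [l' [ij iJ sl' tk']]] : exists i l',
    [/\ (i <= j)%N, (i < J)%N, sel i l' & box i l' (tau k)%:R].
  have [disj|] := eqVneq (box j l `&` cov j) set0.
    by exists j, l; split.
  move=> /set0P[x [xl /coveredP[i [l' [ij sl' xl']]]]].
  exists i, l'; split => //; [exact: ltnW|exact: ltn_trans jJ|].
  by apply: (only_k j i l' l x) => //; [exact: ltnW|exact: ltn_trans jJ].
pose W := boxes (fun a b => box a b (tau k)%:R).
pose W' := boxes (fun a b => ~ box a b (tau k)%:R).
have Wscale x : W x -> exists l'', [/\ sel i l'', box i l'' x & box i l'' (tau k)%:R].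
  move=> [[a b] [/= aJ sab tab] xab]; exists b.
  by rewrite (same_scale sl' sab tk' tab).
have WW' x : W x -> W' x -> False.
  move=> /Wscale[l'' [s1 x1 t1]] [[a b] [/= aJ sab ntab] xab]; apply: ntab.
  have ea := same_scale s1 sab x1 xab.
  by apply: (only_k i a b l'' x) => //; rewrite -ea.
pose C := connected_component (cov J) (tau k)%:R.
have tcov : cov J (tau k)%:R by apply/coveredP; exists i, l'.
have CC : components n delta y C by exists (tau k)%:R.
have Ct : C (tau k)%:R by apply: connected_component_refl.
have CW : C `<=` W.
  have sepW : separated W W'.
    split; rewrite -(closure_id _).1 ?/W ?/W'; try exact: closed_boxes;
    by rewrite -subset0 => x [/WW' h /h].
  have CU : C `<=` W `|` W'.
    move=> x /connected_component_sub /coveredP[a [b [aJ sab xab]]].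
    by have [h|h] := pselect (box a b (tau k)%:R); [left|right]; exists (a, b).
  have connC : connected C by apply: component_connected.
  case: (connected_subset sepW CU connC) => // /(_ _ Ct) h.
  by exfalso; apply: WW' h; exists (i, l').
have [Ci Cs _ [_ Cb] _] := component_props CC.
exists C => //.
have /andP[h1 h2] := Cb _ Ct.
have ri : (2 ^ i)%:R <= (2 ^ j)%:R :> R by rewrite ler_nat leq_pexp2l.
have -> : (2 ^ j).-1%:R = (2 ^ j)%:R - 1 :> R.
  by rewrite -subn1 natrB // expn_gt0.
move: (CW _ Ci) (CW _ Cs) => /Wscale[b1 [_ c1 d1]] /Wscale[b2 [_ c2 d2]].
move: c1 d1 c2 d2; rewrite /box /test_interval /= !in_itv /= => /andP[? ?] /andP[? ?] /andP[? ?] /andP[? ?].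
by rewrite ler_norml /midpoint; apply/andP; split; lra.
Qed.

End Components.

(** * A scale at which a high-energy change-point is tested *)

Section EnergyBounds.
Variable R : realType.

Lemma ln2_ge_half : 1 / 2 <= ln 2 :> R.
Proof.
by rewrite -ler_expR lnK ?posrE //; apply: expR_half_le2.
Qed.

Lemma ln_le_tangent (a x : R) : 0 < a -> 0 < x -> ln x <= ln a + x / a - 1.
Proof.
move=> a0 x0; have xa := divr_gt0 x0 a0.
have -> : ln x = ln a + ln (x / a).
  by rewrite -lnM ?posrE //; congr ln; field; rewrite gt_eqF.
rewrite -addrA lerD2l; have -> : x / a = 1 + (x / a - 1) by ring.
by apply: le_trans (le_ln1Dx _) _; lra.
Qed.

(** Here [E] stands for [m Delta^2].  Put [u = n / (r_k delta) >= 2] and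
    [x = r_k E].  High energy makes [x] at least [2 ^ 16] and [ln u] at most
    [x / 2 ^ 17]; as [ln (n E / delta) = ln u + ln x] and [ln x] is below its
    tangent at [2 ^ 12], this logarithm is a small fraction of [x]. *)
Lemma energy_bounds (n rk delta E : R) : 0 < delta < 1 -> 0 < rk ->
  2 * rk <= n -> 0 <= E ->
  2048 * 64 * ln (n / (rk * delta)) <= rk * E ->
  [/\ 0 < E, 1 <= ln (delta^-1 * n * E) &
      256 * (ln (delta^-1 * n * E) / E) <= rk / 4].
Proof.
move=> /andP[d0 d1] rk0 rkn E0 high.
have rd0 : 0 < rk * delta by rewrite mulr_gt0.
set u := n / (rk * delta) in high.
have u2 : 2 <= u.
  rewrite ler_pdivlMr //.
  by have : rk * delta <= rk by [rewrite ger_pMr // ltW]; lra.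
have lnu : 1 / 2 <= ln u.
  by apply: le_trans ln2_ge_half _; rewrite ler_ln ?posrE //; lra.
set x := rk * E in high.
have x16 : 256 * 256 <= x by lra.
have Egt0 : 0 < E.
  by rewrite lt_neqAle E0 andbT; apply/eqP => E00; move: x16; rewrite /x -E00 mulr0; lra.
have LE : ln (delta^-1 * n * E) = ln u + ln x.
  rewrite -lnM ?posrE //; [|lra|lra]; congr ln; rewrite /u /x.
  by field; rewrite !gt_eqF.
have lnx : ln x <= 11 + x / (64 * 64).
  have h : ln (64 * 64 : R) <= 12.
    have -> : 64 * 64 = 2 ^+ 12 :> R by rewrite !exprS expr0; ring.
    rewrite lnXn // -[leRHS]/(1 *+ 12) lerMn2r /=.
    by have := @le_ln1Dx R 1; rewrite (_ : 1 + 1 = 2 :> R); [apply; lra|lra].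
  by have := @ln_le_tangent (64 * 64) x; lra.
have lnx2 : 1 / 2 <= ln x.
  by apply: le_trans ln2_ge_half _; rewrite ler_ln ?posrE //; lra.
split => //; first by rewrite LE; lra.
rewrite mulrA ler_pdivrMr // LE (_ : rk / 4 * E = x / 4); first by lra.
by rewrite /x; field.
Qed.

Lemma exists_scale (rho : R) : exists2 j : nat, rho <= (2 ^ j)%:R &
  j = 0%N \/ (2 ^ j)%:R < 2 * rho.
Proof.
have ex : exists j, rho <= (2 ^ j)%:R.
  exists (Num.bound `|rho|); apply: le_trans (ler_norm _) _.
  apply: le_trans (ltW (archi_boundP (normr_ge0 rho))) _.
  by rewrite ler_nat; apply/ltnW/ltn_expl.
case: (ex_minnP ex) => -[|j] hj minj; first by exists 0%N; [|left].
exists j.+1 => //; right; rewrite expnS natrM ltr_pM2l // ltNge.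
by apply/negP => /minj; rewrite ltnn.
Qed.

End EnergyBounds.

Lemma scale_facts n j rk : (0 < rk)%N -> (2 * rk <= n)%N ->
  j = 0%N \/ (4 * 2 ^ j <= rk)%N ->
  [/\ (2 ^ j <= rk)%N, (j < scale_count n)%N & (4 * (2 ^ j).-1 < rk)%N].
Proof.
move=> rk0 rkn hj; have le_rk : (2 ^ j <= rk)%N.
  by case: hj => [->|]; [rewrite expn0|apply: leq_trans; rewrite leq_pmull].
split => //.
  by apply: trunc_log_max => //; rewrite expnS; apply: leq_trans rkn; rewrite leq_mul2l.
case: hj => [->|]; first by rewrite expn0 muln0.
by have : (0 < 2 ^ j)%N by [rewrite expn_gt0]; move: (2 ^ j)%N => r; lia.
Qed.

Section HighEnergy.
Context d (T : measurableType d) (R : realType) (P : probability T R).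
Variables (n m : nat) (Y : nat -> 'I_m -> {RV P >-> R}).
Variables (F : nat -> R -> R) (K : nat) (tau : nat -> nat).
Hypothesis model : univariate_model n Y F K tau.
Hypothesis m_gt0 : (0 < m)%N.

Let tau_incr := model_tau_incr model.

Lemma tau_range k : (1 <= k <= K)%N -> (1 < tau k <= n)%N.
Proof.
move=> kK; have := @tau_lt _ _ tau_incr 0 k; have := @tau_lt _ _ tau_incr k K.+1.
by rewrite (model_tau_first model) (model_tau_last model); lia.
Qed.

Lemma cdf_in01 t z : (1 <= t <= n)%N -> 0 <= F t z <= 1.
Proof.
move=> tn; rewrite -!lee_fin -(model_cdf model (Ordinal m_gt0)) //.
by rewrite cdf_ge0 cdf_le1.
Qed.

Lemma jump_diff_le1 k z : (1 <= k <= K)%N ->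
  `|F (tau k) z - F (tau k.-1) z| <= 1.
Proof.
move=> kK; have kn := tau_range kK.
have k1n : (1 <= tau k.-1 <= n)%N.
  have := @tau_lt _ _ tau_incr k.-1 k; have := @tau_le _ _ tau_incr 0 k.-1.
  by rewrite (model_tau_first model); lia.
have /andP[a0 a1] := @cdf_in01 (tau k) z ltac:(lia).
have /andP[b0 b1] := cdf_in01 z k1n.
by rewrite ler_norml; apply/andP; split; lra.
Qed.

(** The window sees one jump, and [l + r - tau_k] of the [r] times of its right
    half lie after it. *)
Lemma mean_cusum_jump k l r z : (1 <= k <= K)%N -> (0 < r)%N -> (r < l)%N ->
  (l <= tau k <= l + r)%N -> (tau k.-1 <= l - r)%N -> (l + r <= tau k.+1)%N ->
  mean_cusum F l r z =
    ((l + r - tau k)%:R / r%:R) * (F (tau k) z - F (tau k.-1) z).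
Proof.
move=> kK r0 rl lk lo hi.
have Fl t : (l - r <= t < tau k)%N -> F t z = F (tau k.-1) z.
  move=> h; rewrite (@model_const _ _ _ _ _ _ _ _ _ _ model k.-1 t) //; first by lia.
  by rewrite prednK; lia.
have Fr t : (tau k <= t < l + r)%N -> F t z = F (tau k) z.
  by move=> h; rewrite (@model_const _ _ _ _ _ _ _ _ _ _ model k t) //; lia.
rewrite /mean_cusum (@big_cat_nat _ _ _ (tau k) l) /=; [|lia|lia].
rewrite (eq_big_nat _ _ (F2 := fun=> F (tau k.-1) z)); last by move=> t h; apply: Fl; lia.
rewrite [X in _ + X - _](eq_big_nat _ _ (F2 := fun=> F (tau k) z));
  last by move=> t h; apply: Fr; lia.
rewrite [X in _ - X](eq_big_nat _ _ (F2 := fun=> F (tau k.-1) z));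
  last by move=> t h; apply: Fl; lia.
rewrite !sumr_const_nat (_ : l - (l - r) = r)%N; last by lia.
rewrite -[_ *+ (tau k - l)]mulr_natr -[_ *+ (l + r - tau k)]mulr_natr -[_ *+ r]mulr_natr.
rewrite !natrB ?natrD; [|lia|lia].
by field; rewrite pnatr_eq0 -lt0n.
Qed.

(** At scale [1] the change-point itself is a location; at larger scales the
    locations are spaced by half the scale, and the last one before [tau_k] is
    taken. *)
Lemma exists_location k j : (1 <= k <= K)%N ->
  (j < scale_count n)%N -> j = 0%N \/ (4 * 2 ^ j <= segment_radius tau k)%N ->
  exists l, [/\ locations n (2 ^ j) l, (l <= tau k)%N,
    (2 * (tau k - l) < 2 ^ j)%N, (tau k.-1 <= l - 2 ^ j)%N & (l + 2 ^ j <= tau k.+1)%N].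
Proof.
move=> kK jJ hj.
have kn := tau_range kK.
have p1 : (tau k.-1 < tau k)%N by apply: (tau_lt tau_incr); lia.
have p2 : (tau k < tau k.+1)%N by apply: (tau_lt tau_incr); lia.
have p0 : (1 <= tau k.-1)%N.
  by rewrite -(model_tau_first model); apply: (tau_le tau_incr); lia.
have p3 : (tau k.+1 <= n.+1)%N.
  by rewrite -(model_tau_last model); apply: (tau_le tau_incr); lia.
have rk1 := geq_minl (tau k.+1 - tau k) (tau k - tau k.-1).
have rk2 := geq_minr (tau k.+1 - tau k) (tau k - tau k.-1).
rewrite -/(segment_radius tau k) in rk1 rk2.
case: j jJ hj => [|j] jJ hj.
  by exists (tau k); rewrite expn0 /locations /=; split; lia.
have {}hj : (4 * 2 ^ j.+1 <= segment_radius tau k)%N by case: hj.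
rewrite expnS in hj *; set h := (2 ^ j)%N in hj *.
have h0 : (0 < h)%N by rewrite expn_gt0.
have := divn_eq (tau k).-1 h; have := ltn_pmod (tau k).-1 h0.
set q := (_ %/ h)%N; set e := (_ %% h)%N => eh tq.
have q2 : (2 <= q)%N by rewrite /q leq_divRL //; lia.
exists (q * h + 1)%N; split; [|lia|lia|lia|lia].
rewrite /locations (_ : (2 * h == 1)%N = false); last by lia.
rewrite mulKn //; left; exists q => //=; rewrite q2 /= leq_subRL.
  by rewrite leq_divRL; [nia|lia].
by rewrite leq_divRL; [nia|lia].
Qed.

(** At a level where the jump exceeds [3/4 Delta], at least half of the times
    of the right half-window come after [tau_k], so the mean statistic exceeds [3/8 Delta].
    The choice of the scale makes both the threshold at most [Delta / 8] and a
    deviation of [Delta / 4] unlikely. *)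
Lemma high_energy_test (delta : R) k : 0 < delta < 1 -> (1 <= k <= K)%N ->
  high_energy F tau n m delta (2048 * 64) k ->
  exists M j l, [/\
    [/\ measurable M & fine (P M) <= delta * (segment_radius tau k)%:R / (2 * n%:R)],
    [/\ (j < scale_count n)%N, locations n (2 ^ j) l &
        (test_interval l (2 ^ j) : set R) (tau k)%:R],
    (4 * (2 ^ j).-1 < segment_radius tau k)%N,
    (2 ^ j).-1%:R <= localization_bound F tau n m delta 256 k /\
    localization_bound F tau n m delta 256 k <= (segment_radius tau k)%:R / 4 &
    forall w, ~ M w -> test n delta (fun t i => Y t i w) l (2 ^ j)].
Proof.
move=> d01 kK; rewrite /high_energy /localization_bound.
set rk := segment_radius tau k; set Delta := jump_height F tau k => high.
have rk0 : (0 < rk)%N := segment_radius_gt0 tau_incr kK.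
have rkn : (2 * rk <= n)%N :=
  segment_radius_half tau_incr (model_tau_first model) (model_tau_last model) kK.
have mR : 0 < m%:R :> R by rewrite ltr0n.
have n_gt0 : (0 < n)%N by lia.
have rkR : 0 < rk%:R :> R by rewrite ltr0n.
have nR : 0 < n%:R :> R by rewrite ltr0n.
have Delta0 : 0 <= Delta by apply: (@supnorm_ge0 _ _ 1) => z; apply: jump_diff_le1.
have Delta1 : Delta <= 1 by apply: supnorm_le => z; apply: jump_diff_le1.
pose E := m%:R * Delta ^+ 2.
have E0 : 0 <= E by rewrite mulr_ge0 // sqr_ge0.
have [||Epos L1 Lrk] := @energy_bounds R n%:R rk%:R delta E d01 rkR _ E0.
- by rewrite -natrM ler_nat.
- rewrite /E mulrCA -ler_pdivrMl // mulrA [m%:R^-1 * _]mulrC; exact: high.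
rewrite -[delta^-1 * n%:R * m%:R * _]mulrA -/E.
set L := ln (_ * E) in L1 Lrk *.
have Dpos : 0 < Delta.
  rewrite lt_neqAle Delta0 andbT; apply/eqP => D0.
  by move: Epos; rewrite /E -D0 expr0n /= mulr0 ltxx.
have [z zlarge] : exists z, 3 / 4 * Delta < `|F (tau k) z - F (tau k.-1) z|.
  by apply: supnorm_gt; rewrite -[supnorm _]/Delta gtr_pMl //; lra.
clearbody Delta.
have [j jlow jup] := exists_scale (128 * (L / E)).
have r_j0 : j = 0%N -> (2 ^ j = 1)%N by move=> ->.
have r_gt0 : (0 < 2 ^ j)%N by rewrite expn_gt0.
have J_j := scale_facts (j := j) rk0 rkn.
have J_l := @locations_bounds n j; have J_loc := exists_location kK (j := j).
rewrite -/rk in J_loc; clearbody rk.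
move: r_j0 r_gt0 J_j J_l J_loc jlow jup.
move Er : (2 ^ j)%N => r r_j0 r_gt0 J_j J_l J_loc jlow jup.
have LE0 : 0 < L / E by rewrite divr_gt0 //; lra.
have rR : 0 < r%:R :> R by rewrite ltr0n.
have hj : j = 0%N \/ (4 * r <= rk)%N.
  case: jup => [->|jup]; [by left|right].
  by rewrite -(ler_nat R) natrM; lra.
have [rrk jJ radj] := J_j hj.
have [l [loc lk lr lo hi]] := J_loc jJ hj.
have [rl lrn] := J_l l n_gt0 jJ loc.
have s01 : 0 <= Delta / 4 <= 1 by lra.
have [M [mM PM Mdev]] := cusum_deviation model m_gt0 r_gt0 rl lrn z s01.
have rE : 128 * L <= r%:R * E by rewrite -ler_pdivrMr // -mulrA.
have q0 : 0 < 4 * n%:R / (delta * r%:R).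
  by case/andP: d01 => d0 _; rewrite divr_gt0 // mulr_gt0.
have lnL : ln (4 * n%:R / (delta * r%:R)) <= L.
  case/andP: d01 => d0 _; rewrite ler_ln ?posrE //; last first.
    by rewrite !mulr_gt0 ?invr_gt0.
  rewrite ler_pdivrMr ?mulr_gt0 //.
  have -> : delta^-1 * n%:R * E * (delta * r%:R) = n%:R * (r%:R * E).
    by field; rewrite gt_eqF.
  by rewrite mulrC ler_pM2l //; lra.
exists M, j, l; rewrite Er; split.
- split => //; apply: le_trans PM _.
  have -> : (m * r)%:R * (Delta / 4) ^+ 2 / 8 = r%:R * E / 128.
    by rewrite natrM /E; field.
  apply: (@le_trans _ _ (2 * expR (- ln (4 * n%:R / (delta * r%:R))))).
    by rewrite ler_pM2l // ler_expR; lra.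
  case/andP: d01 => d0 _.
  rewrite expRN lnK ?posrE // invf_div.
  have -> : 2 * (delta * r%:R / (4 * n%:R)) = delta * r%:R / (2 * n%:R).
    by field; rewrite gt_eqF.
  by rewrite ler_pM2r ?invr_gt0 ?mulr_gt0 // ler_pM2l // ler_nat.
- split => //; apply/test_interval_nat; clear -lk lr r_gt0; lia.
- exact: radj.
- split=> //.
  have rp : r.-1%:R = r%:R - 1 :> R by rewrite -subn1 natrB.
  rewrite rp; case: jup => [/r_j0 ->|jup]; lra.
- move=> w /Mdev dev; rewrite /test.
  set c := cusum _ l r in dev *.
  have csup : `|c z| <= supnorm c.
    by apply: (@le_supnorm _ _ 1) => z'; apply: cusum_le1.
  have thr : threshold n m delta r <= Delta / 8.
    rewrite /threshold.
    have -> : Delta / 8 = Num.sqrt ((Delta / 8) ^+ 2).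
      by rewrite sqrtr_sqr ger0_norm // divr_ge0.
    rewrite ler_sqrt; last exact: sqr_ge0.
    rewrite mulrA ler_pdivrMr ?mulr_gt0 //.
    have -> : (Delta / 8) ^+ 2 * (m%:R * r%:R) = r%:R * E / 64.
      by rewrite /E; field.
    lra.
  rewrite (mean_cusum_jump _ kK) // in dev; last by clear -lk lr; lia.
  set D := F (tau k) z - _ in zlarge dev.
  set a := _ / r%:R in dev.
  have a2 : 1 / 2 <= a.
    rewrite /a ler_pdivlMr //.
    have : (r <= 2 * (l + r - tau k))%N by clear -lk lr; lia.
    by rewrite -(ler_nat R) natrM; lra.
  have : a * `|D| <= `|c z| + Delta / 4.
    have -> : a * `|D| = `|a * D| by rewrite normrM ger0_norm //; lra.
    apply: ltW; rewrite -ltrBlDl; apply: le_lt_trans dev.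
    rewrite distrC; apply: lerB_dist.
  have : 1 / 2 * `|D| <= a * `|D| by rewrite ler_wpM2r.
  lra.
Qed.

End HighEnergy.

(** * Union bounds *)

Section UnionBound.
Context d (T : measurableType d) (R : realType) (P : probability T R).

Lemma union_bound (I : Type) (s : seq I) (E : I -> set T) :
  (forall i, measurable (E i)) ->
  measurable (\big[setU/set0]_(i <- s) E i) /\
  fine (P (\big[setU/set0]_(i <- s) E i)) <= \sum_(i <- s) fine (P (E i)).
Proof.
move=> mE; elim: s => [|i s [mU PU]].
  by rewrite !big_nil measure0; split => //; exact: measurable0.
rewrite !big_cons; split; first exact: measurableU.
apply: le_trans (_ : _ <= fine (P (E i)) + fine (P (\big[setU/set0]_(j <- s) E j))) _.
  rewrite -lee_fin EFinD !fineK ?fin_num_measure //; last exact: measurableU.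
  exact: measureU2.
by rewrite lerD2l.
Qed.

End UnionBound.

(** Contains the locations of scale [2 ^ j], possibly with a repetition; the
    union bound only uses that its length is at most [2 n / 2 ^ j]. *)
Definition location_seq (n j : nat) : seq nat :=
  if j is j'.+1 then
    (n - 2 ^ j + 1)%N ::
      [seq (q * 2 ^ j' + 1)%N | q <- iota 2 ((2 * n) %/ 2 ^ j - 3)]
  else iota 2 n.-1.

Lemma mem_location_seq n j l : locations n (2 ^ j) l -> l \in location_seq n j.
Proof.
rewrite /locations; case: j => [|j] /=.
  by rewrite mem_iota; lia.
rewrite (_ : (2 ^ j.+1 == 1)%N = false); last by rewrite expnS; lia.
rewrite inE expnS mulKn // => -[[q /= qn <-]|->]; last by rewrite eqxx.
by apply/orP; right; apply: map_f; rewrite mem_iota; lia.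
Qed.

Lemma size_location_seq n j : (2 * 2 ^ j <= n)%N ->
  (2 ^ j * size (location_seq n j) <= 2 * n)%N.
Proof.
case: j => [|j] jn; first by rewrite /= size_iota; lia.
rewrite [size _]/= size_map size_iota.
apply: leq_trans (leq_trunc_div (2 * n) (2 ^ j.+1)); rewrite mulnC leq_mul2r.
apply/orP; right; suff : (4 <= (2 * n) %/ 2 ^ j.+1)%N by lia.
by rewrite leq_divRL ?expn_gt0 //; lia.
Qed.

Lemma mem_iota1 K k : (k \in iota 1 K) = (1 <= k <= K)%N.
Proof. by rewrite mem_iota add1n ltnS. Qed.

(** The radius [r_k] is at most [tau_k - tau_(k-1)], and these differences
    telescope. *)
Lemma radius_budget K (tau : nat -> nat) h :
  (forall k, (k <= K)%N -> (tau k < tau k.+1)%N) -> (h <= K)%N ->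
  (\sum_(k <- iota 1 h) segment_radius tau k + tau 0 <= tau h)%N.
Proof.
move=> incr; elim: h => [|h IHh] hK; first by rewrite big_nil.
rewrite (_ : iota 1 h.+1 = iota 1 h ++ [:: h.+1]); last by rewrite -[h.+1 in LHS]addn1 iotaD add1n.
rewrite big_cat /= big_cons big_nil addn0.
have := IHh (ltnW hK); have := incr h (ltnW hK).
have := geq_minr (tau h.+2 - tau h.+1) (tau h.+1 - tau h).
by rewrite /segment_radius /=; lia.
Qed.

Section Budget.
Variables (R : realType) (n : nat) (delta : R).
Hypotheses (n_gt0 : (0 < n)%N) (d01 : 0 < delta < 1).

Let nR : 0 < n%:R :> R. Proof. by rewrite ltr0n. Qed.

(** A scale [r] has at most [2 n / r] locations, so it contributes at most
    [delta^2 r / (2 n)]: the sum is dominated by the largest scale. *)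
Lemma null_budget j : (j <= scale_count n)%N ->
  \sum_(i <- iota 0 j) \sum_(l <- location_seq n i)
    (delta * (2 ^ i)%:R / (2 * n%:R)) ^+ 2 <= delta ^+ 2 / (2 * n%:R) * ((2 ^ j)%:R - 1).
Proof.
elim: j => [|j IHj] jn; first by rewrite big_nil expn0 subrr mulr0.
rewrite -addn1 iotaD big_cat /= add0n big_cons big_nil addr0.
apply: le_trans (lerD (IHj (ltnW jn)) (_ : _ <= delta ^+ 2 / (2 * n%:R) * (2 ^ j)%:R)) _.
  have h : (2 ^ j)%:R * (size (location_seq n j))%:R <= 2 * n%:R :> R.
    by rewrite -!natrM ler_nat size_location_seq // scale_le.
  rewrite big_const_seq count_predT iter_addr_0 -[_ *+ size _]mulr_natl.
  move: h; set r := (2 ^ j)%:R; set s := (size _)%:R => h.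
  have r0 : 0 < r :> R by rewrite ltr0n expn_gt0.
  have -> : s * (delta * r / (2 * n%:R)) ^+ 2 =
      delta ^+ 2 / (2 * n%:R) * r * ((r * s) / (2 * n%:R)).
    by field; rewrite gt_eqF.
  rewrite ler_piMr //; last by rewrite ler_pdivrMr ?mul1r // mulr_gt0.
  by rewrite mulr_ge0 ?divr_ge0 ?sqr_ge0 // ltW.
by rewrite -mulrDr addn1 expnS natrM; apply: ler_wpM2l; [rewrite divr_ge0 ?sqr_ge0|lra].
Qed.

End Budget.

Lemma constant_between_jumps d (T : measurableType d) (R : realType)
    (P : probability T R) (n m : nat) (Y : nat -> 'I_m -> {RV P >-> R})
    (F : nat -> R -> R) (K : nat) (tau : nat -> nat) l r :
  univariate_model n Y F K tau -> (0 < r)%N -> (r < l)%N -> (l + r <= n.+1)%N ->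
  (forall k, (1 <= k <= K)%N -> ~ (test_interval l r : set R) (tau k)%:R) ->
  forall t, (l - r <= t < l + r)%N -> F t = F l.
Proof.
move=> model r_gt0 rl lrn nojump.
have [k kK /andP[klo khi]] : exists2 k, (k <= K)%N & (tau k <= l - r < tau k.+1)%N.
  have ex : exists k, ((k <= K) && (tau k <= l - r))%N.
    by exists 0%N; rewrite (model_tau_first model); lia.
  have ub k : ((k <= K) && (tau k <= l - r))%N -> (k <= K)%N by case/andP.
  case: (ex_maxnP ex ub) => k /andP[kK klo] kmax; exists k => //; rewrite klo /= ltnNge.
  apply/negP => h; have [kK'|kK'] := ltnP k K.
    by have := kmax k.+1; rewrite kK' h ltnn => /(_ isT).
  by have ek : k = K by [lia]; move: h; rewrite ek (model_tau_last model); lia.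
have hi : (l + r <= tau k.+1)%N.
  have [kK'|kK'] := ltnP k K; last first.
    have ek : k = K by lia.
    by rewrite ek (model_tau_last model).
  rewrite leqNgt; apply/negP => h; apply: (nojump k.+1); first by lia.
  by apply/test_interval_nat; lia.
have Fk t : (l - r <= t < l + r)%N -> F t = F (tau k).
  by move=> ht; apply: (model_const model) => //; lia.
by move=> t ht; rewrite Fk // (Fk l) //; lia.
Qed.

Theorem proposition7 (R : realType) :
  exists c1 c2 : R, [/\ 0 < c1, 0 < c2 &
  forall (n m : nat) (delta : R),
    (2 <= n)%N -> (1 <= m)%N -> 0 < delta < 1 ->
  forall (d : measure_display) (T : measurableType d) (P : probability T R)
    (Y : nat -> 'I_m -> {RV P >-> R}) (F : nat -> R -> R)
    (K : nat) (tau : nat -> nat),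
    univariate_model n Y F K tau ->
  exists A : set T, [/\ measurable A, ((1 - delta)%:E < P A)%E &
  forall w : T, A w ->
    let Chat := components n delta (fun t i => Y t i w) in
    no_spurious Chat (@midpoint R) K tau /\
    (forall k : nat, (1 <= k <= K)%N ->
      high_energy F tau n m delta c1 k ->
      [/\ detected Chat (@midpoint R) tau k,
          (dist_H1 Chat (@midpoint R) (tau k)%:R
             <= (localization_bound F tau n m delta c2 k)%:E)%E &
          localization_bound F tau n m delta c2 k
             <= (segment_radius tau k)%:R / 4])]].
Proof.
exists (2048 * 64), 256; split; [by apply: mulr_gt0; rewrite ltr0n|by rewrite ltr0n|].
move=> n m delta n2 m_gt0 d01 d T P Y F K tau model.
have n_gt0 : (0 < n)%N by lia.
have nR : 0 < n%:R :> R by rewrite ltr0n.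
have [d0 d1] := andP d01.
have tau_incr := model_tau_incr model.
have tau0 := model_tau_first model; have tauK := model_tau_last model.
pose nojump j l := forall k, (1 <= k <= K)%N ->
  ~ (test_interval l (2 ^ j) : set R) (tau k)%:R.
(* The exceptional sets exist for all indices, so that they can be chosen
   uniformly; they are empty where nothing is required. *)
have null jl : exists E : set T, [/\ measurable E,
    fine (P E) <= (delta * (2 ^ jl.1)%:R / (2 * n%:R)) ^+ 2 &
    (jl.1 < scale_count n)%N -> locations n (2 ^ jl.1) jl.2 -> nojump jl.1 jl.2 ->
    forall w, ~ E w -> ~~ test n delta (fun t i => Y t i w) jl.2 (2 ^ jl.1)].
  case: jl => j l /=; have [[jJ loc nj]|no] := pselect
    [/\ (j < scale_count n)%N, locations n (2 ^ j) l & nojump j l]; last first.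
    exists set0; split; first exact: measurable0.
      by rewrite measure0 sqr_ge0.
    by move=> jJ loc nj; case: no.
  have [rl lrn] := locations_bounds n_gt0 jJ loc.
  have r0 : (0 < 2 ^ j)%N by rewrite expn_gt0.
  have [E [mE PE Et]] := null_test_tail model m_gt0 r0 rl lrn d01
    (scale_le n_gt0 jJ) (constant_between_jumps model r0 rl lrn nj).
  by exists E.
have [N /all_and3[mN PN Ntest]] := choice null.
have power k : exists M : set T, [/\ measurable M,
    (1 <= k <= K)%N -> fine (P M) <= delta * (segment_radius tau k)%:R / (2 * n%:R) &
    (1 <= k <= K)%N -> high_energy F tau n m delta (2048 * 64) k ->
    exists j l, [/\
    [/\ (j < scale_count n)%N, locations n (2 ^ j) l &
        (test_interval l (2 ^ j) : set R) (tau k)%:R],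
    (4 * (2 ^ j).-1 < segment_radius tau k)%N,
    (2 ^ j).-1%:R <= localization_bound F tau n m delta 256 k,
    localization_bound F tau n m delta 256 k <= (segment_radius tau k)%:R / 4 &
    forall w, ~ M w -> test n delta (fun t i => Y t i w) l (2 ^ j)]].
  have [[kK he]|no] := pselect ((1 <= k <= K)%N /\
    high_energy F tau n m delta (2048 * 64) k); last first.
    exists set0; split; first exact: measurable0.
      by move=> _; rewrite measure0 /= divr_ge0 ?mulr_ge0 // ltW.
    by move=> kK he; case: no.
  have [M [j [l [[mM PM] box rad [lb1 lb2] tst]]]] := high_energy_test model m_gt0 d01 kK he.
  by exists M; split => // _ _; exists j, l; split.
have [M /all_and3[mM PM Mtest]] := choice power.
pose grid := [seq (j, l) | j <- iota 0 (scale_count n), l <- location_seq n j].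
have [mNU PNU] := union_bound P grid mN.
have [mMU PMU] := union_bound P (iota 1 K) mM.
set NU := \big[setU/set0]_(i <- grid) N i in mNU PNU.
set MU := \big[setU/set0]_(i <- iota 1 K) M i in mMU PMU.
have NU_lt : fine (P NU) < delta / 2.
  apply: le_lt_trans PNU _; rewrite big_allpairs_dep /=.
  apply: (@le_lt_trans _ _ (delta ^+ 2 / (2 * n%:R) * ((2 ^ scale_count n)%:R - 1))).
    apply: le_trans _ (null_budget delta n_gt0 (leqnn _)).
    by apply: ler_sum => j _; apply: ler_sum => l _; apply: PN.
  have h : (2 ^ scale_count n)%:R - 1 < n%:R :> R.
    have : (2 ^ scale_count n <= n)%N by apply: trunc_logP.
    by rewrite -(ler_nat R) => h; lra.
  apply: (@lt_trans _ _ (delta ^+ 2 / (2 * n%:R) * n%:R)).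
    by rewrite ltr_pM2l // divr_gt0 ?mulr_gt0 // exprn_gt0.
  have -> : delta ^+ 2 / (2 * n%:R) * n%:R = delta * (delta / 2).
    by field; rewrite gt_eqF.
  by rewrite gtr_pMl //; lra.
have MU_le : fine (P MU) <= delta / 2.
  apply: le_trans PMU _.
  apply: (@le_trans _ _ (\sum_(k <- iota 1 K) delta / (2 * n%:R) * (segment_radius tau k)%:R)).
    rewrite big_seq [leRHS]big_seq; apply: ler_sum => k; rewrite mem_iota1 => kK.
    by rewrite mulrAC; apply: PM.
  rewrite -mulr_sumr -natr_sum.
  have : (\sum_(k <- iota 1 K) segment_radius tau k <= n)%N.
    have := radius_budget tau_incr (leqnn K).
    rewrite tau0 addn1 => /ltn_trans/(_ (tau_incr K (leqnn K))).
    by rewrite tauK ltnS.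
  rewrite -(ler_nat R) => h.
  have -> : delta / 2 = delta / (2 * n%:R) * n%:R by field; rewrite gt_eqF.
  by rewrite ler_pM2l // divr_gt0 ?mulr_gt0.
exists (~` (NU `|` MU)); split.
- exact/measurableC/measurableU.
- rewrite probability_setC; last exact: measurableU.
  rewrite -(@fineK _ (P (NU `|` MU))) ?fin_num_measure //; last exact: measurableU.
  rewrite -EFinB lte_fin ltrD2l ltrN2.
  apply: (@le_lt_trans _ _ (fine (P NU) + fine (P MU))); last by lra.
  rewrite -lee_fin EFinD !fineK ?fin_num_measure //; last exact: measurableU.
  exact: measureU2.
move=> w; rewrite setCU => -[nN nM] Chat.
have notN j l : (j < scale_count n)%N -> locations n (2 ^ j) l -> ~ N (j, l) w.
  move=> jJ loc Nw; apply: nN; rewrite /NU -bigcup_seq; exists (j, l) => //=.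
  by apply: allpairs_f_dep; [rewrite mem_iota|apply: mem_location_seq].
have notM k : (1 <= k <= K)%N -> ~ M k w.
  move=> kK Mw; apply: nM; rewrite /MU -bigcup_seq; exists k => //=.
  by rewrite mem_iota1.
have hit j l : (j < scale_count n)%N ->
    selected n delta (fun t i => Y t i w) (2 ^ j)
      (covered n delta (fun t i => Y t i w) j) l ->
    exists2 k, (1 <= k <= K)%N & (test_interval l (2 ^ j) : set R) (tau k)%:R.
  move=> jJ [loc tst _]; apply: contrapT => no.
  have nj : nojump j l by move=> k kK bk; apply: no; exists k.
  by move: tst; apply/negP; apply: (Ntest (j, l)) => //; apply: notN.

have := no_spurious_components n_gt0 tau0 tauK tau_incr hit => nosp; split; first by [].
move=> k kK he.
have [j [l [[jJ loc box] rad lb1 lb2 tst]]] := Mtest k kK he.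
have [C CC dist] := detection n_gt0 tau0 tauK tau_incr hit kK jJ loc (tst _ (notM k kK)) box rad.
split => //.
- exists C => //.
  have rkR : (2 ^ j).-1%:R <= (segment_radius tau k)%:R / 4 :> R by apply: le_trans lb1 lb2.
  have p1 : (tau k.-1 < tau k)%N by apply: (tau_lt tau_incr); clear -kK; lia.
  have p2 : (tau k < tau k.+1)%N by apply: (tau_lt tau_incr); clear -kK; lia.
  have g1 : (segment_radius tau k)%:R <= (tau k.+1)%:R - (tau k)%:R :> R.
    by rewrite -natrB ?(ltnW p2) // ler_nat; apply: geq_minl.
  have g2 : (segment_radius tau k)%:R <= (tau k)%:R - (tau k.-1)%:R :> R.
    by rewrite -natrB ?(ltnW p1) // ler_nat; apply: geq_minr.
  move: (le_trans dist rkR); rewrite inE /cell /= in_itv /= /left_end /right_end.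
  have g0 : 0 <= (segment_radius tau k)%:R :> R by [].
  rewrite ler_norml => /andP[dist1 dist2].
  by apply/andP; split; lra.
- apply: ereal_inf_le; exists (`|midpoint C - (tau k)%:R|%:E); first by exists C.
  by rewrite lee_fin; apply: le_trans dist lb1.
Qed.
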